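(* Let $X$ be a Polish space. For the generic compact set $K\subseteq X$, either $K$ is finite, or there is a continuous gauge function $h$ such that $0<\mathcal{H}^{h}(K)<\infty$ and for every weak contraction $f\colon K\to X$ we have $\mathcal{H}^{h}(K\cap f(K))=0$.
   Context: $\mathcal{K}(X)$ denotes the set of non-empty compact subsets of $X$ with the Hausdorff metric $d_H(K_1,K_2)=\min\{r: K_1\subseteq B(K_2,r),\ K_2\subseteq B(K_1,r)\}$, where $B(A,r)=\{x: \operatorname{dist}(A,\{x\})\le r\}$. ''The generic compact set has property P'' means the set of $K\in\mathcal{K}(X)$ with property P is co-meager in $\mathcal{K}(X)$. A gauge function is a function $h\colon[0,\infty)\to[0,\infty)$ that is non-decreasing, right-continuous, and satisfies $h(x)=0$ iff $x=0$. For $A\subseteq X$, $\mathcal{H}^h_\delta(A)=\inf\{\sum_{i=1}^\infty h(\operatorname{diam}A_i): A\subseteq\bigcup_i A_i,\ \operatorname{diam}A_i\le\delta\}$ and $\mathcal{H}^h(A)=\lim_{\delta\to0+}\mathcal{H}^h_\delta(A)$. A map $f\colon K\to X$ is a weak contraction if $d(f(x_1),f(x_2))<d(x_1,x_2)$ for all $x_1\ne x_2$ in $K$. *)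

(* Defs.v *)
From Stdlib Require Import Reals List Classical ClassicalEpsilon.
Open Scope R_scope.

Section MetricDefs.
Variable X : Type.
Variable d : X -> X -> R.

Definition is_metric : Prop :=
  (forall x y, 0 <= d x y) /\
  (forall x y, d x y = 0 <-> x = y) /\
  (forall x y, d x y = d y x) /\
  (forall x y z, d x z <= d x y + d y z).

Definition complete : Prop :=
  forall u : nat -> X,
    (forall eps, 0 < eps -> exists N, forall m n, (N <= m)%nat -> (N <= n)%nat -> d (u m) (u n) < eps) ->
    exists l, forall eps, 0 < eps -> exists N, forall n, (N <= n)%nat -> d (u n) l < eps.

(** separability: a countable dense subset (encoded by nat -> option X so that
    the empty space is allowed) *)
Definition separable : Prop :=
  exists s : nat -> option X,
    forall x eps, 0 < eps -> exists n y, s n = Some y /\ d x y < eps.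

Definition polish : Prop := is_metric /\ complete /\ separable.

Definition open_set (U : X -> Prop) : Prop :=
  forall x, U x -> exists r, 0 < r /\ forall y, d x y < r -> U y.

Definition compact (K : X -> Prop) : Prop :=
  forall (I : Type) (U : I -> X -> Prop),
    (forall i, open_set (U i)) ->
    (forall x, K x -> exists i, U i x) ->
    exists l : list I, forall x, K x -> exists i, In i l /\ U i x.

Definition nonempty_compact (K : X -> Prop) : Prop :=
  (exists x, K x) /\ compact K.

Definition KX : Type := { K : X -> Prop | nonempty_compact K }.

(** B(A,r) = { x : dist(A,{x}) <= r }, where dist(A,{x}) = inf_{a in A} d a x *)
Definition Bset (A : X -> Prop) (r : R) (x : X) : Prop :=
  forall eps, 0 < eps -> exists a, A a /\ d a x < r + eps.

Definition subset (A B : X -> Prop) : Prop := forall x, A x -> B x.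

Definition dH_set (K1 K2 : X -> Prop) (r : R) : Prop :=
  subset K1 (Bset K2 r) /\ subset K2 (Bset K1 r).

Definition is_min (S : R -> Prop) (m : R) : Prop :=
  S m /\ forall r, S r -> m <= r.

Definition dH (K1 K2 : KX) : R :=
  epsilon (inhabits 0) (is_min (dH_set (proj1_sig K1) (proj1_sig K2))).

Definition closureK (A : KX -> Prop) (K : KX) : Prop :=
  forall eps, 0 < eps -> exists L, A L /\ dH K L < eps.

Definition nowhere_dense (A : KX -> Prop) : Prop :=
  ~ exists K eps, 0 < eps /\ forall L, dH K L < eps -> closureK A L.

Definition meager (A : KX -> Prop) : Prop :=
  exists N : nat -> KX -> Prop,
    (forall n, nowhere_dense (N n)) /\ forall K, A K -> exists n, N n K.

Definition generic (P : KX -> Prop) : Prop :=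
  meager (fun K => ~ P K).

Definition finite_set (A : X -> Prop) : Prop :=
  exists l : list X, forall x, A x -> In x l.

(** diameter: sup { d x y : x, y in A } (with value 0 for the empty set);
    only used for sets with bounded diameter, where the sup exists *)
Definition diam_le (A : X -> Prop) (delta : R) : Prop :=
  forall x y, A x -> A y -> d x y <= delta.

Definition diam (A : X -> Prop) : R :=
  epsilon (inhabits 0)
    (is_lub (fun r => r = 0 \/ exists x y, A x /\ A y /\ r = d x y)).

(** H^h_delta(A) <= c  (c real): the infimum over countable delta-covers
    of sum_i h(diam A_i) is <= c, i.e. for every eps > 0 there is a cover
    whose (possibly infinite) sum is < c + eps. *)
Definition Hdelta_le (h : R -> R) (A : X -> Prop) (delta c : R) : Prop :=
  forall eps, 0 < eps ->
    exists C : nat -> X -> Prop,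
      (forall x, A x -> exists i, C i x) /\
      (forall i, diam_le (C i) delta) /\
      exists b, b < c + eps /\
        forall n, sum_f_R0 (fun i => h (diam (C i))) n <= b.

(** H^h(A) <= c : H^h(A) = lim_{delta -> 0+} H^h_delta(A), and as
    H^h_delta(A) is non-increasing in delta, this limit is the supremum over
    delta > 0. *)
Definition Hh_le (h : R -> R) (A : X -> Prop) (c : R) : Prop :=
  forall delta, 0 < delta -> Hdelta_le h A delta c.

Definition Hh_zero (h : R -> R) (A : X -> Prop) : Prop :=
  forall c, 0 < c -> Hh_le h A c.

Definition Hh_pos_finite (h : R -> R) (A : X -> Prop) : Prop :=
  ~ Hh_le h A 0 /\ exists c, Hh_le h A c.

(** weak contraction f : K -> X (values of f off K are irrelevant) *)
Definition weak_contraction (K : X -> Prop) (f : X -> X) : Prop :=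
  forall x1 x2, K x1 -> K x2 -> x1 <> x2 -> d (f x1) (f x2) < d x1 x2.

Definition image (f : X -> X) (K : X -> Prop) (y : X) : Prop :=
  exists x, K x /\ f x = y.

End MetricDefs.

(** gauge function h : [0,oo) -> [0,oo) (values at negative arguments are
    irrelevant) *)
Definition gauge (h : R -> R) : Prop :=
  (forall x, 0 <= x -> 0 <= h x) /\
  (forall x y, 0 <= x -> x <= y -> h x <= h y) /\
  (forall x, 0 <= x -> forall eps, 0 < eps ->
     exists del, 0 < del /\ forall y, x <= y < x + del -> Rabs (h y - h x) < eps) /\
  (forall x, 0 <= x -> (h x = 0 <-> x = 0)).

Definition continuous_on_nonneg (h : R -> R) : Prop :=
  forall x, 0 <= x -> forall eps, 0 < eps ->
    exists del, 0 < del /\ forall y, 0 <= y -> Rabs (y - x) < del -> Rabs (h y - h x) < eps.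

(* Main.v *)
Require Import Defs.
From Stdlib Require Import Reals List Classical ClassicalEpsilon Lra Lia Cantor.
Open Scope R_scope.

(** A generic compact set [K] avoids the boundary of the set of isolated points of [X], so it
    is a finite set together with a part [K'] lying in the region without isolated points.
    Suppose [K'] splits into classes of diameter at most [rho] which are far apart on the
    scale [rho].  Near [K] there is a finite set with equally many points in each class, and
    any compact set close to it again splits, on a much smaller scale, into classes, equally
    many in each old one.  This step can be iterated for generic [K], because the set of
    compact sets for which it fails at a given rational scale is nowhere dense.  The gauge
    [h] is chosen so that h(diam) of a class of level m is about 1/M_m, where M_m is the
    number of classes of that level: the classes give finite measure, and counting
    descendants in a finite subcover gives positive measure.

    For the contractions, let [din] and [dout] be disjoint regions (a ball around a point of a
    countable dense set and the complement of a larger ball).  The new points can be chosen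
    so that new classes in [din] are further apart than the diameters of sets covering the
    part of [K'] in [dout], with the number of these sets negligible compared to the number
    of new classes.  A weak contraction then maps each of these sets into one class, so
    the part of [K' \cap f(K')] in [din] with a preimage in [dout] is null.  Countably many
    such pairs of regions, each treated at infinitely many levels, account for all points
    of [K' \cap f(K')] except for the at most one fixed point of [f]. *)

(** * Finite counts and sums *)

Fixpoint cnt {A : Type} (P : A -> Prop) (l : list A) : nat :=
  match l with
  | nil => 0
  | x :: l' => (if excluded_middle_informative (P x) then 1 else 0) + cnt P l'
  end.

Fixpoint lsum {A : Type} (g : A -> R) (l : list A) : R :=
  match l with
  | nil => 0
  | x :: l' => g x + lsum g l'
  end.

Section Lists.
Context {A : Type}.
Implicit Types (P Q : A -> Prop) (l : list A) (g : A -> R).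

Lemma cnt_app P l1 l2 : cnt P (l1 ++ l2) = (cnt P l1 + cnt P l2)%nat.
Proof. induction l1 as [|x l1 IH]; simpl; lia. Qed.

Lemma cnt_mono P Q l : (forall x, In x l -> P x -> Q x) -> (cnt P l <= cnt Q l)%nat.
Proof.
  induction l as [|x l IH]; simpl; intros H; [lia|].
  assert (IH' : (cnt P l <= cnt Q l)%nat) by (apply IH; auto).
  destruct (excluded_middle_informative (P x)) as [p|p];
    destruct (excluded_middle_informative (Q x)) as [q|q]; try lia.
  exfalso; apply q, H; auto.
Qed.

Lemma cnt_ext P Q l : (forall x, In x l -> (P x <-> Q x)) -> cnt P l = cnt Q l.
Proof.
  intros H; apply Nat.le_antisymm; apply cnt_mono; intros x i; apply H; exact i.
Qed.

Lemma cnt_all P l : (forall x, In x l -> P x) -> cnt P l = length l.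
Proof.
  induction l as [|x l IH]; simpl; intros H; [reflexivity|].
  destruct (excluded_middle_informative (P x)) as [p|p]; [|destruct p; auto].
  rewrite IH; auto.
Qed.

Lemma cnt_none P l : (forall x, In x l -> ~ P x) -> cnt P l = 0%nat.
Proof.
  induction l as [|x l IH]; simpl; intros H; [reflexivity|].
  destruct (excluded_middle_informative (P x)) as [p|p]; [destruct (H x); auto|].
  rewrite IH; auto.
Qed.

Lemma cnt_le_length P l : (cnt P l <= length l)%nat.
Proof.
  rewrite <- (cnt_all (fun _ => True) l) by auto. apply cnt_mono; auto.
Qed.

Lemma cnt_map {B : Type} (P : B -> Prop) (f : A -> B) l :
  cnt P (map f l) = cnt (fun x => P (f x)) l.
Proof. induction l as [|x l IH]; simpl; lia. Qed.

Lemma cnt_or P Q l :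
  (forall x, In x l -> P x -> ~ Q x) ->
  cnt (fun x => P x \/ Q x) l = (cnt P l + cnt Q l)%nat.
Proof.
  induction l as [|x l IH]; simpl; intros H; [reflexivity|].
  rewrite IH by auto.
  destruct (excluded_middle_informative (P x)) as [p|p];
    destruct (excluded_middle_informative (Q x)) as [q|q];
    destruct (excluded_middle_informative (P x \/ Q x)) as [r|r]; try lia;
    exfalso; firstorder.
Qed.

Lemma cnt_or_le P Q l : (cnt (fun x => P x \/ Q x) l <= cnt P l + cnt Q l)%nat.
Proof.
  induction l as [|x l IH]; simpl; [lia|].
  destruct (excluded_middle_informative (P x)) as [p|p];
    destruct (excluded_middle_informative (Q x)) as [q|q];
    destruct (excluded_middle_informative (P x \/ Q x)) as [r|r]; try lia;
    exfalso; firstorder.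
Qed.

Lemma cnt_cover (C : nat -> A -> Prop) (b : nat -> R) (n : nat) l :
  (forall i, (i <= n)%nat -> INR (cnt (C i) l) <= b i) ->
  INR (cnt (fun x => exists i, (i <= n)%nat /\ C i x) l) <= sum_f_R0 b n.
Proof.
  induction n as [|n IH]; intros H.
  - simpl. apply Rle_trans with (2 := H 0%nat (le_n 0)). apply le_INR, cnt_mono.
    intros x _ [i [Hi HC]]. replace i with 0%nat in HC by lia. exact HC.
  - simpl sum_f_R0.
    apply Rle_trans with
      (INR (cnt (fun x => (exists i, (i <= n)%nat /\ C i x) \/ C (S n) x) l)).
    + apply le_INR, cnt_mono. intros x _ [i [Hi HC]].
      destruct (Nat.eq_dec i (S n)) as [->|ne]; [right; exact HC|].
      left; exists i; split; [lia|exact HC].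
    + eapply Rle_trans; [apply le_INR, cnt_or_le|]. rewrite plus_INR.
      apply Rplus_le_compat; [apply IH; intros i Hi; apply H; lia|apply H; lia].
Qed.

Lemma lsum_app g l1 l2 : lsum g (l1 ++ l2) = lsum g l1 + lsum g l2.
Proof. induction l1 as [|x l1 IH]; simpl; lra. Qed.

Lemma lsum_nonneg g l : (forall x, In x l -> 0 <= g x) -> 0 <= lsum g l.
Proof.
  induction l as [|x l IH]; simpl; intros H; [lra|].
  apply Rplus_le_le_0_compat; auto.
Qed.

Lemma lsum_le_const g l c : (forall x, In x l -> g x <= c) -> lsum g l <= INR (length l) * c.
Proof.
  induction l as [|x l IH]; intros H; [simpl; lra|].
  cbn [lsum length]. rewrite S_INR.
  assert (g x <= c) by (apply H; left; auto).
  assert (lsum g l <= INR (length l) * c) by (apply IH; intros; apply H; right; auto).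
  lra.
Qed.

Lemma lsum_incl g l l' :
  (forall x, 0 <= g x) -> NoDup l -> incl l l' -> lsum g l <= lsum g l'.
Proof.
  intros Hg; revert l'; induction l as [|x l IH]; intros l' nd inc.
  - apply lsum_nonneg; auto.
  - inversion_clear nd as [|? ? nx nd'].
    destruct (in_split x l') as [l1 [l2 ->]]; [apply inc; left; auto|].
    assert (lsum g l <= lsum g (l1 ++ l2)).
    { apply IH; [exact nd'|]. intros y Hy.
      destruct (in_app_or l1 (x :: l2) y) as [i|[e|i]];
        [apply inc; right; exact Hy|..]; try (apply in_or_app; auto; fail).
      subst y; contradiction. }
    rewrite lsum_app in *; simpl; lra.
Qed.

Lemma lsum_map {B : Type} (g : B -> R) (f : A -> B) l :
  lsum g (map f l) = lsum (fun x => g (f x)) l.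
Proof. induction l as [|x l IH]; simpl; lra. Qed.

Lemma lsum_le_ptwise g g' l : (forall x, In x l -> g x <= g' x) -> lsum g l <= lsum g' l.
Proof.
  induction l as [|x l IH]; simpl; intros H; [lra|].
  apply Rplus_le_compat; auto.
Qed.

(** The smallest of the radii works, since each [Q x] persists below its own radius. This turns
    pointwise choices on a finite set into a uniform one. *)
Lemma finite_radius (Q : A -> R -> Prop) l :
  (forall x, In x l -> exists e, 0 < e /\ forall e', 0 < e' <= e -> Q x e') ->
  exists e, 0 < e /\ forall e', 0 < e' <= e -> forall x, In x l -> Q x e'.
Proof.
  induction l as [|x l IH]; intros H.
  - exists 1; split; [lra|intros ? ? ? []].
  - destruct (H x) as [e1 [e1p H1]]; [left; auto|].
    destruct IH as [e2 [e2p H2]]; [intros; apply H; right; auto|].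
    exists (Rmin e1 e2); split; [apply Rmin_glb_lt; auto|].
    intros e' He' y [<-|i].
    + apply H1; split; [lra|]. apply Rle_trans with (1 := proj2 He'), Rmin_l.
    + apply H2; auto; split; [lra|]. apply Rle_trans with (1 := proj2 He'), Rmin_r.
Qed.

End Lists.

Lemma sum_f_R0_lsum (g : nat -> R) n : sum_f_R0 g n = lsum g (seq 0 (S n)).
Proof.
  induction n as [|n IH]; [simpl; lra|].
  rewrite seq_S, lsum_app, <- IH. simpl; lra.
Qed.

Lemma lsum_prod {A B : Type} (g : A * B -> R) (l : list A) (l' : list B) :
  lsum g (list_prod l l') = lsum (fun x => lsum (fun y => g (x, y)) l') l.
Proof.
  induction l as [|x l IH]; simpl; [reflexivity|].
  now rewrite lsum_app, lsum_map, IH.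
Qed.

(** Cantor's code of [(i, j)] is at least [i + j], so the first [n + 1] pairs lie in the square with
    both indices at most [n], each occurring once. *)
Lemma sum_cantor_le (g : nat * nat -> R) (n : nat) :
  (forall p, 0 <= g p) ->
  sum_f_R0 (fun k => g (of_nat k)) n <=
  sum_f_R0 (fun i => sum_f_R0 (fun j => g (i, j)) n) n.
Proof.
  intros Hg. rewrite !sum_f_R0_lsum.
  rewrite <- (lsum_map g of_nat).
  apply Rle_trans with (lsum g (list_prod (seq 0 (S n)) (seq 0 (S n)))).
  - apply lsum_incl; [exact Hg|..].
    + apply NoDup_map_NoDup_ForallPairs; [|apply seq_NoDup].
      intros a b _ _ e; apply of_nat_inj; exact e.
    + intros [i j] H. apply in_map_iff in H. destruct H as [k [e Hk]].
      apply in_seq in Hk. pose proof (to_nat_non_decreasing i j) as L.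
      rewrite <- e, cancel_to_of in L.
      apply in_prod; apply in_seq; lia.
  - rewrite lsum_prod. apply lsum_le_ptwise. intros i _.
    rewrite sum_f_R0_lsum; lra.
Qed.

Lemma sum_geometric_le (c : R) (n : nat) :
  0 <= c -> sum_f_R0 (fun i => c * (1/2) ^ S i) n <= c.
Proof.
  intros Hc.
  assert (E : sum_f_R0 (fun i => c * (1/2) ^ S i) n = c - c * (1/2) ^ S n).
  { induction n as [|n IH]; [simpl; lra|].
    change (sum_f_R0 (fun i => c * (1/2) ^ S i) (S n))
      with (sum_f_R0 (fun i => c * (1/2) ^ S i) n + c * (1/2) ^ S (S n)).
    rewrite IH. simpl; lra. }
  rewrite E.
  assert (0 < (1/2) ^ S n) by (apply pow_lt; lra).
  nra.
Qed.

(** * Hausdorff measures *)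

Section Measure.
Variable X : Type.
Variable d : X -> X -> R.
Hypothesis Hd : is_metric X d.

Lemma metric_pos x y : 0 <= d x y.
Proof. apply Hd. Qed.

Lemma metric_self x : d x x = 0.
Proof. apply Hd; reflexivity. Qed.

Lemma metric_eq x y : d x y = 0 -> x = y.
Proof. apply Hd. Qed.

Lemma metric_sym x y : d x y = d y x.
Proof. apply Hd. Qed.

Lemma metric_tri x y z : d x z <= d x y + d y z.
Proof. apply Hd. Qed.

Lemma metric_lt_pos x y : x <> y -> 0 < d x y.
Proof.
  intros ne. destruct (Rle_lt_or_eq_dec 0 (d x y) (metric_pos x y)) as [p|e]; [exact p|].
  destruct ne; apply metric_eq; auto.
Qed.

(** The bound [delta] makes the supremum exist, so the choice in [diam] returns it. *)
Lemma diam_is_lub (A : X -> Prop) (delta : R) :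
  0 <= delta -> diam_le X d A delta ->
  is_lub (fun r => r = 0 \/ exists x y, A x /\ A y /\ r = d x y) (diam X d A).
Proof.
  intros H0 HA. unfold diam. apply epsilon_spec.
  destruct (completeness (fun r => r = 0 \/ exists x y, A x /\ A y /\ r = d x y))
    as [m Hm].
  - exists delta. intros r [-> |[x [y [Ax [Ay ->]]]]]; auto.
  - exists 0; auto.
  - exists m; exact Hm.
Qed.

Lemma diam_bounds (A : X -> Prop) (delta : R) :
  0 <= delta -> diam_le X d A delta -> 0 <= diam X d A <= delta.
Proof.
  intros H0 HA. destruct (diam_is_lub A delta H0 HA) as [U L]. split.
  - apply U; auto.
  - apply L. intros r [-> |[x [y [Ax [Ay ->]]]]]; auto.
Qed.

Lemma dist_le_diam (A : X -> Prop) (delta : R) x y :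
  0 <= delta -> diam_le X d A delta -> A x -> A y -> d x y <= diam X d A.
Proof.
  intros H0 HA Ax Ay. apply (diam_is_lub A delta H0 HA). right; eauto.
Qed.

Variable h : R -> R.
Hypothesis Hh : gauge h.

Lemma gauge_pos x : 0 <= x -> 0 <= h x.
Proof. apply Hh. Qed.

Lemma gauge_0 : h 0 = 0.
Proof. apply Hh; lra. Qed.

Lemma gauge_diam_nonneg (A : X -> Prop) (delta : R) :
  0 <= delta -> diam_le X d A delta -> 0 <= h (diam X d A).
Proof. intros H0 HA. apply gauge_pos. apply (diam_bounds A delta H0 HA). Qed.

(** Finite covers suffice: the list is padded with empty sets, which have diameter 0 and cost
    [h 0 = 0]. *)
Lemma Hdelta_le_list (A : X -> Prop) (delta c : R) (Cs : list (X -> Prop)) :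
  0 < delta ->
  (forall x, A x -> exists C, In C Cs /\ C x) ->
  (forall C, In C Cs -> diam_le X d C delta) ->
  lsum (fun C => h (diam X d C)) Cs <= c ->
  Hdelta_le X d h A delta c.
Proof.
  intros Hdel Hcov Hdiam Hsum eps Heps.
  pose (E := fun _ : X => False).
  assert (HE : diam_le X d E 0) by (intros x y []).
  assert (E0 : h (diam X d E) = 0).
  { destruct (diam_bounds E 0 (Rle_refl 0) HE).
    replace (diam X d E) with 0 by lra. apply gauge_0. }
  exists (fun i => nth i Cs E). split; [|split].
  - intros x Ax. destruct (Hcov x Ax) as [C [iC Cx]].
    destruct (In_nth Cs C E iC) as [i [_ e]]. exists i; rewrite e; exact Cx.
  - intros i. destruct (nth_in_or_default i Cs E) as [k| ->]; [auto|intros x y []].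
  - exists c; split; [lra|]. intros n. apply Rle_trans with (2 := Hsum).
    rewrite sum_f_R0_lsum, <- (lsum_map (fun C => h (diam X d C)) (fun i => nth i Cs E)).
    clear Hcov Hsum. generalize (S n) as m. clear n.
    induction Cs as [|C Cs IH]; intros m.
    + rewrite lsum_map. apply Rle_trans with (INR (length (seq 0 m)) * 0); [|simpl; lra].
      apply lsum_le_const. intros i _. destruct i; simpl; lra.
    + destruct m as [|m].
      * apply lsum_nonneg; intros K iK.
        apply (gauge_diam_nonneg K delta); [lra|auto].
      * cbn [seq map lsum nth]. rewrite <- seq_shift, map_map.
        apply Rplus_le_compat_l. apply IH; intros K iK; apply Hdiam; right; exact iK.
Qed.

Lemma Hdelta_le_mono (A B : X -> Prop) (delta c : R) :
  (forall x, A x -> B x) -> Hdelta_le X d h B delta c -> Hdelta_le X d h A delta c.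
Proof.
  intros s H eps He. destruct (H eps He) as [C [cov rest]]. exists C; auto.
Qed.

Lemma Hh_zero_mono (A B : X -> Prop) :
  (forall x, A x -> B x) -> Hh_zero X d h B -> Hh_zero X d h A.
Proof.
  intros s H c Hc delta Hdel. apply Hdelta_le_mono with (1 := s). apply H; auto.
Qed.

Lemma singletons_sum_zero (l : list X) :
  lsum (fun C => h (diam X d C)) (map (fun x y => y = x) l) = 0.
Proof.
  rewrite lsum_map. induction l as [|x l IH]; simpl; [reflexivity|].
  rewrite IH.
  assert (S : diam_le X d (fun y => y = x) 0).
  { intros a b -> ->. rewrite metric_self; lra. }
  destruct (diam_bounds _ 0 (Rle_refl 0) S).
  replace (diam X d (fun y => y = x)) with 0 by lra. rewrite gauge_0; lra.
Qed.

Lemma Hh_zero_list (l : list X) : Hh_zero X d h (fun x => In x l).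
Proof.
  intros c Hc delta Hdel.
  apply Hdelta_le_list with (Cs := map (fun x y => y = x) l); auto.
  - intros x i. exists (fun y => y = x). split; [apply in_map_iff; eauto|reflexivity].
  - intros C iC. apply in_map_iff in iC. destruct iC as [x [<- _]].
    intros a b -> ->. rewrite metric_self; lra.
  - rewrite singletons_sum_zero; lra.
Qed.

(** The set of index [k] gets a cover of cost at most [c / 2^(k+1)]; Cantor's pairing merges all
    covers into one sequence. *)
Lemma Hh_zero_countable_union (A : nat -> X -> Prop) :
  (forall k, Hh_zero X d h (A k)) -> Hh_zero X d h (fun x => exists k, A k x).
Proof.
  intros H c Hc delta Hdel eps Heps.
  assert (W : forall k, exists C : nat -> X -> Prop,
    (forall x, A k x -> exists i, C i x) /\
    (forall i, diam_le X d (C i) delta) /\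
    forall n, sum_f_R0 (fun i => h (diam X d (C i))) n <= c * (1/2) ^ S k).
  { intros k. assert (P : 0 < c * (1/2) ^ S k / 2).
    { assert (0 < (1/2) ^ S k) by (apply pow_lt; lra). nra. }
    destruct (H k _ P delta Hdel _ P) as [C [c1 [c2 [b [b1 b2]]]]].
    exists C; split; [exact c1|split; [exact c2|]].
    intros n; specialize (b2 n); lra. }
  destruct (choice _ W) as [C HC].
  exists (fun n => C (fst (of_nat n)) (snd (of_nat n))). split; [|split].
  - intros x [k Ak]. destruct (HC k) as [cov _]. destruct (cov x Ak) as [i Ci].
    exists (to_nat (k, i)). rewrite cancel_of_to; exact Ci.
  - intros n. apply HC.
  - exists c; split; [lra|]. intros n.
    apply Rle_trans with
      (1 := sum_cantor_le (fun p => h (diam X d (C (fst p) (snd p)))) n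
              (fun p => gauge_diam_nonneg _ delta (Rlt_le _ _ Hdel)
                          (proj1 (proj2 (HC (fst p))) (snd p)))).
    apply Rle_trans with (2 := sum_geometric_le c n (Rlt_le _ _ Hc)).
    apply sum_Rle. intros k _. exact (proj2 (proj2 (HC k)) n).
Qed.

End Measure.

(** * Trees of separated pieces *)

(* The distances realised in [P] avoid the interval (rho, r); hence being at distance at most
   [rho] is an equivalence relation on [P], and [l] picks one point of each class. *)
Definition level (X : Type) (d : X -> X -> R) (P : X -> Prop) (rho r : R) (l : list X) : Prop :=
  0 < rho /\ 4 * rho <= r /\ rho * INR (length l) <= r /\ l <> nil /\ NoDup l /\
  (forall p, In p l -> P p) /\
  (forall x, P x -> exists p, In p l /\ d p x <= rho) /\
  (forall x y, P x -> P y -> d x y <= rho \/ r <= d x y) /\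
  (forall p q, In p l -> In q l -> d p q <= rho -> p = q).

(* Classes of the new level inside [din] are [sigma]-separated, whereas the part of [P] in
   [dout] splits into few sets of diameter below [sigma]: a weak contraction maps each of them
   into a single class. *)
Definition refines (X : Type) (d : X -> X -> R) (P din dout : X -> Prop) (n : nat)
    (rho : R) (l : list X) (rho' r' : R) (l' : list X) : Prop :=
  r' <= rho /\
  (exists a, (2 <= a)%nat /\ forall p, In p l -> cnt (fun q => d p q <= rho) l' = a) /\
  exists (zs : list X) (sigma : R),
    (n * length zs <= length l')%nat /\
    (forall x, P x -> dout x -> exists z, In z zs /\ d z x < sigma / 2) /\
    (forall y y', P y -> P y' -> din y -> din y' -> d y y' <= rho' \/ sigma <= d y y').

Section Tree.
Variable X : Type.
Variable d : X -> X -> R.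
Hypothesis Hd : is_metric X d.

Lemma level_class_trans (P : X -> Prop) rho r l x y z :
  level X d P rho r l -> P x -> P z -> d x y <= rho -> d y z <= rho -> d x z <= rho.
Proof.
  intros [H0 [H1 [_ [_ [_ [_ [_ [gap _]]]]]]]] Px Pz xy yz.
  pose proof (metric_tri X d Hd x y z).
  destruct (gap x z Px Pz); lra.
Qed.

(** The classes of [l] cut [l'] into blocks of [a] points, and [S] has one truth value on a
    representative and its block. *)
Lemma cnt_children (P S : X -> Prop) rho r (l l' : list X) (a : nat) :
  level X d P rho r l -> (forall q, In q l' -> P q) ->
  (forall p, In p l -> cnt (fun q => d p q <= rho) l' = a) ->
  (forall p q, In p l -> In q l' -> d p q <= rho -> (S p <-> S q)) ->
  cnt S l' = (a * cnt S l)%nat.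
Proof.
  intros L Hl' Ha HS.
  pose proof L as [H0 [H1 [_ [_ [nd [lP [cov [gap rep]]]]]]]].
  transitivity (cnt (fun q => exists p, In p l /\ S p /\ d p q <= rho) l').
  - apply cnt_ext. intros q iq. split.
    + intros Sq. destruct (cov q (Hl' q iq)) as [p [ip pq]].
      exists p; split; [exact ip|split; [|exact pq]]. apply (HS p q); auto.
    + intros [p [ip [Sp pq]]]. apply (HS p q); auto.
  (* The induction runs over sublists [k], because a proper sublist of [l] no longer represents
     every class. *)
  - assert (G : forall k, NoDup k -> incl k l ->
      cnt (fun q => exists p, In p k /\ S p /\ d p q <= rho) l' = (a * cnt S k)%nat).
    { induction k as [|p k IH]; intros ndk inc.
      - rewrite cnt_none; [simpl; lia|]. intros q _ [p [[] _]].
      - inversion_clear ndk as [|? ? np ndk'].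
        assert (ip : In p l) by (apply inc; left; auto).
        assert (ik : incl k l) by (intros y Hy; apply inc; right; auto).
        rewrite (cnt_ext _ (fun q => (S p /\ d p q <= rho) \/
                   exists p, In p k /\ S p /\ d p q <= rho)).
        2:{ intros q _; split.
            - intros [p' [[<-|i] R]]; [left|right; exists p']; auto.
            - intros [R|[p' [i R]]]; [exists p|exists p']; simpl; auto. }
        rewrite cnt_or, IH; auto.
        + simpl. destruct (excluded_middle_informative (S p)) as [s|s].
          * rewrite (cnt_ext _ (fun q => d p q <= rho)) by (intros; tauto).
            rewrite Ha by exact ip. lia.
          * rewrite cnt_none by (intros; tauto). lia.
        + intros q iq [_ pq] [p' [ip' [_ p'q]]].
          assert (p = p').
          { apply rep; auto. rewrite metric_sym in p'q by exact Hd.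
            apply (level_class_trans P rho r l p q p'); auto. }
          subst p'; contradiction. }
    apply G; [exact nd|apply incl_refl].
Qed.

(** * Sequences of successively refined levels *)

Variable P : X -> Prop.
Variables (rho r : nat -> R) (l : nat -> list X).
Variables (din dout : nat -> X -> Prop).
Hypothesis Hlev : forall m, level X d P (rho m) (r m) (l m).
(** Step [m] serves the pair of regions and the ratio that [m] codes, so every pair is served once
    for each ratio. *)
Hypothesis Href : forall m,
  refines X d P (din (fst (of_nat m))) (dout (fst (of_nat m))) (snd (of_nat m))
    (rho m) (l m) (rho (S m)) (r (S m)) (l (S m)).

Lemma rho_pos m : 0 < rho m.
Proof. apply Hlev. Qed.

Lemma r_ge m : 4 * rho m <= r m.
Proof. apply Hlev. Qed.

Lemma r_succ_le m : r (S m) <= rho m.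
Proof. apply Href. Qed.

Lemma reps_in m p : In p (l m) -> P p.
Proof. apply Hlev. Qed.

Lemma rho_decr m m' : (m <= m')%nat -> rho m' <= rho m.
Proof.
  induction 1 as [|m' _ IH]; [lra|].
  pose proof (r_ge (S m')). pose proof (r_succ_le m'). pose proof (rho_pos (S m')). lra.
Qed.

Lemma r_decr m m' : (m <= m')%nat -> r m' <= r m.
Proof.
  induction 1 as [|m' _ IH]; [lra|].
  pose proof (r_ge m'). pose proof (r_succ_le m'). pose proof (rho_pos m'). lra.
Qed.

Lemma length_succ m :
  exists a, (2 <= a)%nat /\ (forall p, In p (l m) -> cnt (fun q => d p q <= rho m) (l (S m)) = a) /\
    length (l (S m)) = (a * length (l m))%nat.
Proof.
  destruct (Href m) as [_ [[a [a2 Ha]] _]]. exists a; split; [exact a2|split; [exact Ha|]].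
  rewrite <- (cnt_all (fun _ => True) (l (S m))), <- (cnt_all (fun _ => True) (l m)) by auto.
  apply (cnt_children P (fun _ => True) (rho m) (r m)); auto; try tauto.
  apply reps_in.
Qed.

Lemma length_ge m : (m + 1 <= length (l m))%nat.
Proof.
  induction m as [|m IH].
  - destruct (Hlev 0%nat) as [_ [_ [_ [ne _]]]]. destruct (l 0%nat); simpl; [tauto|lia].
  - destruct (length_succ m) as [a [a2 [_ ->]]]. nia.
Qed.

Lemma length_pos m : 0 < INR (length (l m)).
Proof. apply lt_0_INR. pose proof (length_ge m); lia. Qed.

Lemma length_INR_ge m : INR m + 1 <= INR (length (l m)).
Proof. rewrite <- S_INR. apply le_INR. pose proof (length_ge m); lia. Qed.

(** With [M_m] classes at level [m], [rho m * M_m <= r m <= r 0], while [M_m >= m + 1]. *)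
Lemma rho_lim e : 0 < e -> exists N, forall m, (N <= m)%nat -> rho m < e.
Proof.
  intros He. destruct (INR_unbounded (r 0%nat / e)) as [N HN]. exists N. intros m Hm.
  destruct (Hlev m) as [p [_ [b _]]].
  pose proof (r_decr 0 m (Nat.le_0_l m)). pose proof (length_INR_ge m).
  apply le_INR in Hm.
  assert (r 0%nat < INR N * e).
  { apply Rmult_lt_reg_r with (/ e); [apply Rinv_0_lt_compat; lra|].
    replace (INR N * e * / e) with (INR N) by (field; lra). exact HN. }
  destruct (Rlt_le_dec (rho m) e) as [q|q]; [exact q|].
  assert (INR N * e <= rho m * INR (length (l m))); [|lra].
  pose proof (pos_INR N). nra.
Qed.

(** All classes of level [m] have equally many descendants at level [m']. Each refinement multiplies
    both sides by the same factor, since a class of level [m] is a union of classes of any later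
    level. *)
Lemma cnt_descendants m m' p : (m <= m')%nat -> In p (l m) ->
  (cnt (fun q => (d p q <= rho m)%R) (l m') * length (l m) = length (l m'))%nat.
Proof.
  intros le ip. induction le as [|m' le IH].
  - enough (E : cnt (fun q => d p q <= rho m) (l m) = 1%nat) by (rewrite E; lia).
    destruct (Hlev m) as [H0 [_ [_ [_ [nd [_ [_ [_ rep]]]]]]]].
    rewrite (cnt_ext _ (fun q => q = p)).
    2:{ intros q iq; split; [intros pq; symmetry; apply rep; auto|intros ->].
        rewrite metric_self by exact Hd; lra. }
    clear rep. induction (l m) as [|x k IH]; [destruct ip|].
    inversion_clear nd as [|? ? nx nd']. simpl.
    destruct (excluded_middle_informative (x = p)) as [e|e].
    + subst x. rewrite cnt_none; [lia|]. intros q iq ->; contradiction.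
    + destruct ip as [e'|ip]; [contradiction|]. rewrite IH; auto.
  - destruct (length_succ m') as [a [_ [Ha ->]]].
    rewrite (cnt_children P _ (rho m') (r m') (l m') (l (S m')) a); auto.
    + rewrite <- IH; lia.
    + apply reps_in.
    + intros q q' iq iq' qq'. pose proof (rho_decr m m' le).
      apply reps_in in ip; apply reps_in in iq; apply reps_in in iq'.
      split; intros K.
      * apply (level_class_trans P (rho m) (r m) (l m) p q q'); auto; lra.
      * rewrite metric_sym in qq' by exact Hd.
        apply (level_class_trans P (rho m) (r m) (l m) p q' q); auto; lra.
Qed.

(** * The gauge function of a sequence of levels *)

Definition gauge_line (t : R) (m : nat) : R := (1 + t / rho m) / INR (length (l m)).

(* An infimum of affine functions: it is concave, hence continuous, and lies between 1/M_m and
   2/M_m on [r_(m+1), rho_m], where M_m is the number of classes of level m. *)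
Definition tree_gauge (t : R) : R :=
  epsilon (inhabits 0) (fun g => (forall m, g <= gauge_line t m) /\
    forall b, (forall m, b <= gauge_line t m) -> b <= g).

Lemma div_rho_nonneg t m : 0 <= t -> 0 <= t / rho m.
Proof.
  intros Ht. apply Rmult_le_pos; [exact Ht|]. left; apply Rinv_0_lt_compat, rho_pos.
Qed.

Lemma tree_gauge_inf t : 0 <= t ->
  (forall m, tree_gauge t <= gauge_line t m) /\
  forall b, (forall m, b <= gauge_line t m) -> b <= tree_gauge t.
Proof.
  intros Ht. unfold tree_gauge. apply epsilon_spec.
  destruct (completeness (fun y => exists m, y = - gauge_line t m)) as [g [ub lub]].
  - exists 0. intros y [m ->].
    assert (0 <= gauge_line t m); [|lra].
    apply Rmult_le_pos; [pose proof (div_rho_nonneg t m Ht); lra|].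
    left; apply Rinv_0_lt_compat, length_pos.
  - exists (- gauge_line t 0), 0%nat; reflexivity.
  - exists (- g); split.
    + intros m. assert (- gauge_line t m <= g) by (apply ub; eauto). lra.
    + intros b Hb. assert (g <= - b); [|lra].
      apply lub. intros y [m ->]. specialize (Hb m); lra.
Qed.

Lemma tree_gauge_nonneg t : 0 <= t -> 0 <= tree_gauge t.
Proof.
  intros Ht. apply tree_gauge_inf; [exact Ht|]. intros m.
  apply Rmult_le_pos; [pose proof (div_rho_nonneg t m Ht); lra|].
  left; apply Rinv_0_lt_compat, length_pos.
Qed.

Lemma tree_gauge_mono s t : 0 <= s -> s <= t -> tree_gauge s <= tree_gauge t.
Proof.
  intros Hs st. apply tree_gauge_inf; [lra|]. intros m.
  apply Rle_trans with (gauge_line s m); [apply tree_gauge_inf; exact Hs|].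
  apply Rmult_le_compat_r; [left; apply Rinv_0_lt_compat, length_pos|].
  apply Rplus_le_compat_l, Rmult_le_compat_r; [|exact st].
  left; apply Rinv_0_lt_compat, rho_pos.
Qed.

(** The quotient of the gauge by its argument is non-increasing, as it is for every line with
    nonnegative value at 0. This form of concavity yields continuity away from 0. *)
Lemma tree_gauge_scale s t : 0 <= s <= t -> s * tree_gauge t <= t * tree_gauge s.
Proof.
  intros [Hs st]. destruct (Req_dec t 0) as [e|ne].
  { replace s with t by lra. lra. }
  apply Rmult_le_reg_r with (/ t); [apply Rinv_0_lt_compat; lra|].
  replace (t * tree_gauge s * / t) with (tree_gauge s) by (field; lra).
  apply tree_gauge_inf; [exact Hs|]. intros m.
  assert (T : tree_gauge t <= gauge_line t m) by (apply tree_gauge_inf; lra).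
  assert (0 <= s * / t) by (apply Rmult_le_pos; [|left; apply Rinv_0_lt_compat]; lra).
  apply Rle_trans with (s * / t * gauge_line t m); [nra|].
  unfold gauge_line. pose proof (rho_pos m). pose proof (length_pos m).
  replace (s * / t * ((1 + t / rho m) / INR (length (l m))))
    with ((s / t + s / rho m) / INR (length (l m))) by (field; lra).
  apply Rmult_le_compat_r; [left; apply Rinv_0_lt_compat; lra|].
  apply Rplus_le_compat_r. apply Rmult_le_reg_r with t; [lra|].
  replace (s / t * t) with s by (field; lra). lra.
Qed.

Lemma tree_gauge_rho m : tree_gauge (rho m) <= 2 / INR (length (l m)).
Proof.
  pose proof (rho_pos m).
  apply Rle_trans with (gauge_line (rho m) m); [apply tree_gauge_inf; lra|].
  unfold gauge_line. replace (rho m / rho m) with 1 by (field; lra). lra.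
Qed.

(** Lines with [j <= m] start at [1 / M_j >= 1 / M_m]. For [j > m], [rho j * M_j <= r j <= t], so
    the line is already at least 1 at [t]. *)
Lemma tree_gauge_lower m t : r (S m) <= t -> / INR (length (l m)) <= tree_gauge t.
Proof.
  intros Ht. pose proof (r_ge (S m)). pose proof (rho_pos (S m)).
  apply tree_gauge_inf; [lra|]. intros j. unfold gauge_line.
  pose proof (length_pos m). pose proof (length_pos j). pose proof (rho_pos j).
  pose proof (div_rho_nonneg t j ltac:(lra)).
  destruct (Nat.le_gt_cases j m) as [jm|jm].
  - apply Rle_trans with (/ INR (length (l j))).
    + apply Rinv_le_contravar; [lra|]. apply le_INR. clear - jm Href Hlev Hd.
      induction jm as [|m jm IH]; [lia|].
      destruct (length_succ m) as [a [a2 [_ ->]]]. nia.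
    + unfold Rdiv at 1. rewrite <- (Rmult_1_l (/ INR (length (l j)))) at 1.
      apply Rmult_le_compat_r; [left; apply Rinv_0_lt_compat|]; lra.
  - apply Rle_trans with 1.
    + rewrite <- Rinv_1. apply Rinv_le_contravar; [lra|].
      pose proof (length_INR_ge m). pose proof (pos_INR m). lra.
    + apply Rmult_le_reg_r with (INR (length (l j))); [lra|].
      replace ((1 + t / rho j) / INR (length (l j)) * INR (length (l j)))
        with (1 + t / rho j) by (field; lra).
      enough (INR (length (l j)) <= t / rho j) by lra.
      apply Rmult_le_reg_r with (rho j); [lra|].
      replace (t / rho j * rho j) with t by (field; lra).
      destruct (Hlev j) as [_ [_ [b _]]].
      pose proof (r_decr (S m) j jm). lra.
Qed.

Lemma tree_gauge_small e : 0 < e -> exists t, 0 < t /\ tree_gauge t < e.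
Proof.
  intros He. destruct (INR_unbounded (2 / e)) as [m Hm].
  exists (rho m). split; [apply rho_pos|].
  apply Rle_lt_trans with (1 := tree_gauge_rho m).
  pose proof (length_INR_ge m). pose proof (length_pos m).
  apply Rmult_lt_reg_r with (INR (length (l m))); [lra|].
  replace (2 / INR (length (l m)) * INR (length (l m))) with 2 by (field; lra).
  assert (2 < INR m * e); [|nra].
  apply Rmult_lt_reg_r with (/ e); [apply Rinv_0_lt_compat; lra|].
  replace (INR m * e * / e) with (INR m) by (field; lra). exact Hm.
Qed.

Lemma tree_gauge_0 : tree_gauge 0 = 0.
Proof.
  pose proof (tree_gauge_nonneg 0 (Rle_refl 0)) as [p|e]; [|auto].
  destruct (tree_gauge_small _ p) as [t [tp Ht]].
  pose proof (tree_gauge_mono 0 t (Rle_refl 0) (Rlt_le _ _ tp)). lra.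
Qed.

Lemma tree_gauge_pos t : 0 < t -> 0 < tree_gauge t.
Proof.
  intros Ht. destruct (rho_lim t Ht) as [m Hm].
  apply Rlt_le_trans with (/ INR (length (l m))); [apply Rinv_0_lt_compat, length_pos|].
  apply tree_gauge_lower. pose proof (r_succ_le m). specialize (Hm m (le_n m)). lra.
Qed.

Lemma tree_gauge_continuous : continuous_on_nonneg tree_gauge.
Proof.
  intros x [Hx|<-] e He.
  - pose proof (tree_gauge_pos x Hx) as gx.
    set (c := tree_gauge x) in *.
    (* By monotonicity and [tree_gauge_scale] the gauge changes by at most [c * |y - x| / x] between
       [x] and [y]. *)
    exists (Rmin (x / 2) (x * e / (4 * c))). split.
    { apply Rmin_glb_lt; [lra|]. apply Rdiv_lt_0_compat; nra. }
    intros y Hy yx.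
    assert (Y1 : Rabs (y - x) < x / 2)
      by (eapply Rlt_le_trans; [exact yx|apply Rmin_l]).
    assert (Y2 : Rabs (y - x) < x * e / (4 * c))
      by (eapply Rlt_le_trans; [exact yx|apply Rmin_r]).
    assert (Y3 : Rabs (y - x) * (4 * c) < x * e).
    { apply Rmult_lt_reg_r with (/ (4 * c)); [apply Rinv_0_lt_compat; lra|].
      replace (Rabs (y - x) * (4 * c) * / (4 * c)) with (Rabs (y - x)) by (field; lra).
      exact Y2. }
    apply Rabs_def2 in Y1.
    destruct (Rle_lt_dec x y) as [xy|xy].
    + rewrite Rabs_right in Y3 by lra.
      pose proof (tree_gauge_scale x y ltac:(lra)) as S.
      pose proof (tree_gauge_mono x y ltac:(lra) xy) as M. fold c in S, M |- *.
      rewrite Rabs_right by lra.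
      apply Rmult_lt_reg_l with x; [lra|]. nra.
    + rewrite Rabs_left in Y3 by lra.
      pose proof (tree_gauge_scale y x ltac:(lra)) as S.
      pose proof (tree_gauge_mono y x Hy ltac:(lra)) as M. fold c in S, M |- *.
      apply Rabs_def1; [lra|].
      apply Rmult_lt_reg_l with x; [lra|]. nra.
  - destruct (tree_gauge_small e He) as [t [tp Ht]]. exists t; split; [exact tp|].
    intros y Hy yt. rewrite tree_gauge_0, !Rminus_0_r in *.
    rewrite Rabs_right in yt by lra.
    rewrite Rabs_right by (pose proof (tree_gauge_nonneg y Hy); lra).
    pose proof (tree_gauge_mono y t Hy ltac:(lra)). lra.
Qed.

Lemma tree_gauge_gauge : gauge tree_gauge.
Proof.
  split; [exact tree_gauge_nonneg|split; [exact tree_gauge_mono|split]].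
  - intros x Hx e He. destruct (tree_gauge_continuous x Hx e He) as [del [dp H]].
    exists del; split; [exact dp|]. intros y Hy. apply H; [lra|].
    rewrite Rabs_right; lra.
  - intros x [Hx|<-].
    + split; intros E; [pose proof (tree_gauge_pos x Hx)|]; lra.
    + split; intros _; [reflexivity|apply tree_gauge_0].
Qed.


(** * Hausdorff measure estimates for the tree gauge *)

(** The [M_m] classes of a fine level cost at most [2 / M_m] each, and the singletons of [F] cost
    nothing. *)
Lemma tree_Hh_le (K : X -> Prop) (F : list X) :
  (forall x, K x -> P x \/ In x F) -> Hh_le X d tree_gauge K 2.
Proof.
  intros KF delta Hdel. destruct (rho_lim (delta / 2) ltac:(lra)) as [m Hm].
  specialize (Hm m (le_n m)). pose proof (rho_pos m).
  pose (cls := fun p x => P x /\ d p x <= rho m).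
  assert (D : forall p, In p (l m) -> diam_le X d (cls p) (rho m)).
  { intros p ip x y [Px px] [Py py].
    rewrite metric_sym in px by exact Hd.
    apply (level_class_trans P (rho m) (r m) (l m) x p y); auto. }
  apply Hdelta_le_list with (Cs := map cls (l m) ++ map (fun x y => y = x) F);
    [exact tree_gauge_gauge|exact Hdel|..].
  - intros x Kx. destruct (KF x Kx) as [Px|iF].
    + destruct (Hlev m) as [_ [_ [_ [_ [_ [_ [cov _]]]]]]].
      destruct (cov x Px) as [p [ip px]]. exists (cls p).
      split; [apply in_or_app; left; apply in_map; exact ip|split; auto].
    + exists (fun y => y = x). split; [|reflexivity].
      apply in_or_app; right. apply in_map_iff; exists x; auto.
  - intros C iC. apply in_app_or in iC. destruct iC as [iC|iC]; apply in_map_iff in iC.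
    + destruct iC as [p [<- ip]]. intros x y Cx Cy.
      apply Rle_trans with (1 := D p ip x y Cx Cy). lra.
    + destruct iC as [p [<- ip]]. intros x y -> ->. rewrite metric_self by exact Hd. lra.
  - rewrite lsum_app, singletons_sum_zero by (exact Hd || exact tree_gauge_gauge).
    rewrite Rplus_0_r, lsum_map.
    apply Rle_trans with (INR (length (l m)) * (2 / INR (length (l m)))).
    + apply lsum_le_const. intros p ip.
      apply Rle_trans with (2 := tree_gauge_rho m).
      destruct (diam_bounds X d (cls p) (rho m) ltac:(lra) (D p ip)).
      apply tree_gauge_mono; auto.
    + pose proof (length_pos m). right; field; lra.
Qed.

Lemma tree_scale t m : r m <= t < r 0%nat ->
  exists j, (j < m)%nat /\ r (S j) <= t < r j.
Proof.
  induction m as [|m IH]; intros [H1 H2]; [lra|].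
  destruct (Rle_lt_dec (r m) t) as [H|H].
  - destruct (IH (conj H H2)) as [j [jm Hj]]. exists j; split; [lia|exact Hj].
  - exists m; split; [lia|lra].
Qed.

(** If [r (S j) <= t < r j], then [U] meets at most one class of level [j]. That class carries the
    fraction [1 / M_j] of the points of level [m], and the gauge at [t] is at least [1 / M_j]. *)
Lemma tree_mass_bound (U : X -> Prop) t m :
  r m <= t < r 0%nat -> (forall x y, U x -> U y -> d x y < t) ->
  INR (cnt U (l m)) <= INR (length (l m)) * tree_gauge t.
Proof.
  intros Ht HU.
  assert (t0 : 0 <= t) by (pose proof (r_ge m); pose proof (rho_pos m); lra).
  destruct (classic (exists q, In q (l m) /\ U q)) as [[q [iq Uq]]|none].
  2:{ rewrite cnt_none by (intros x ix Ux; apply none; eauto).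
      apply Rmult_le_pos; [apply pos_INR|apply tree_gauge_nonneg; exact t0]. }
  destruct (tree_scale t m Ht) as [j [jm Hj]].
  pose proof (reps_in m q iq) as Pq.
  destruct (Hlev j) as [_ [_ [_ [_ [_ [_ [cov [gap _]]]]]]]].
  destruct (cov q Pq) as [p [ip pq]].
  apply Rle_trans with (INR (cnt (fun x => d p x <= rho j) (l m))).
  - apply le_INR, cnt_mono. intros x ix Ux. pose proof (reps_in m x ix) as Px.
    apply (level_class_trans P (rho j) (r j) (l j) p q x); auto.
    + apply (reps_in j); exact ip.
    + destruct (gap q x Pq Px) as [g|g]; [exact g|]. specialize (HU q x Uq Ux). lra.
  - rewrite <- (cnt_descendants j m p) by (auto; lia). rewrite mult_INR.
    rewrite Rmult_assoc. rewrite <- (Rmult_1_r (INR (cnt _ _))) at 1.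
    apply Rmult_le_compat_l; [apply pos_INR|].
    pose proof (length_pos j). rewrite <- (Rinv_r (INR (length (l j)))) by lra.
    apply Rmult_le_compat_l; [lra|]. apply tree_gauge_lower. lra.
Qed.

(** Mass distribution principle for the counting measures on the levels: a cover of cost below 1/2
    is enlarged to an open one of cost below 1, and a finite subcover would contain fewer points of
    a fine level than there are. The open set [O] takes care of the rest of [K]. *)
Lemma tree_positive (K O : X -> Prop) :
  Defs.compact X d K -> (forall x, P x -> K x) -> Defs.open_set X d O ->
  (forall x, P x -> ~ O x) -> (forall x, K x -> P x \/ O x) ->
  ~ Hh_le X d tree_gauge K 0.
Proof.
  intros cK PK oO PO KO H.
  pose proof (r_ge 0). pose proof (rho_pos 0).
  destruct (H (r 0%nat / 2) ltac:(lra) (1/2) ltac:(lra)) as [C [cov [dC [b [b1 b2]]]]].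
  assert (DB := fun i => diam_bounds X d (C i) (r 0%nat / 2) ltac:(lra) (dC i)).
  (* Right-continuity of the gauge leaves room to enlarge each set; the extra costs add up to at
     most 1/2. *)
  assert (E : forall i, exists t, diam X d (C i) < t < r 0%nat /\
    tree_gauge t <= tree_gauge (diam X d (C i)) + (1/2) * (1/2) ^ S i).
  { intros i. specialize (DB i).
    assert (0 < (1/2) * (1/2) ^ S i) by (assert (0 < (1/2) ^ S i) by (apply pow_lt; lra); lra).
    destruct (proj1 (proj2 (proj2 tree_gauge_gauge)) _ (proj1 DB) _ H2) as [e [ep He]].
    pose proof (Rmin_l e (r 0%nat / 2)). pose proof (Rmin_r e (r 0%nat / 2)).
    assert (0 < Rmin e (r 0%nat / 2)) by (apply Rmin_glb_lt; lra).
    exists (diam X d (C i) + Rmin e (r 0%nat / 2) / 2). split; [lra|].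
    specialize (He (diam X d (C i) + Rmin e (r 0%nat / 2) / 2) ltac:(lra)).
    apply Rabs_def2 in He. lra. }
  destruct (choice _ E) as [t Ht].
  pose (U := fun i x => exists c, C i c /\ d x c < (t i - diam X d (C i)) / 2).
  assert (oU : forall i, Defs.open_set X d (U i)).
  { intros i x [c [Cc xc]]. exists ((t i - diam X d (C i)) / 2 - d x c). split; [lra|].
    intros y xy. exists c; split; [exact Cc|]. pose proof (metric_tri X d Hd y x c).
    rewrite (metric_sym X d Hd y x) in H2. lra. }
  assert (dU : forall i x y, U i x -> U i y -> d x y < t i).
  { intros i x y [c [Cc xc]] [c' [Cc' yc]].
    pose proof (dist_le_diam X d (C i) (r 0%nat / 2) c c' ltac:(lra) (dC i) Cc Cc').
    pose proof (metric_tri X d Hd x c y). pose proof (metric_tri X d Hd c c' y).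
    rewrite (metric_sym X d Hd c' y) in *. lra. }
  destruct (cK (option nat) (fun o => match o with Some i => U i | None => O end))
    as [L HL].
  { intros [i|]; auto. }
  { intros x Kx. destruct (cov x Kx) as [i Ci]. exists (Some i), x. split; [exact Ci|].
    rewrite metric_self by exact Hd. specialize (Ht i). lra. }
  assert (N : exists n, forall i, In (Some i) L -> (i <= n)%nat).
  { clear. induction L as [|o L [n IH]]; [exists 0%nat; intros i []|].
    destruct o as [k|].
    - exists (k + n)%nat. intros i [e|iL]; [injection e; lia|specialize (IH i iL); lia].
    - exists n. intros i [e|iL]; [discriminate|auto]. }
  destruct N as [n Hn].
  (* A level with [r] below all the [t i] of the subcover is needed for [tree_mass_bound]. *)
  destruct (finite_radius (fun i e => e <= t i) (seq 0 (S n))) as [e [ep He]].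
  { intros i _. exists (t i). split; [destruct (Ht i), (DB i); lra|]. intros; lra. }
  destruct (rho_lim e ep) as [m Hm].
  assert (T : INR (length (l (S m))) <=
    sum_f_R0 (fun i => INR (length (l (S m))) * tree_gauge (t i)) n).
  { rewrite <- (cnt_all (fun x => exists i, (i <= n)%nat /\ U i x) (l (S m))) at 1.
    - apply cnt_cover. intros i Hi. apply tree_mass_bound; [|apply dU].
      split; [|apply Ht]. specialize (Hm m (le_n m)). pose proof (r_succ_le m).
      specialize (He e ltac:(lra) i ltac:(apply in_seq; lia)). lra.
    - intros x ix. apply reps_in in ix. destruct (HL x (PK x ix)) as [[i|] [iL Ux]].
      + exists i; auto.
      + destruct (PO x ix Ux). }
  pose proof (length_pos (S m)) as Lp.
  assert (B : sum_f_R0 (fun i => tree_gauge (t i)) n <= b + 1/2).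
  { apply Rle_trans with (sum_f_R0 (fun i => tree_gauge (diam X d (C i)) + (1/2) * (1/2) ^ S i) n).
    - apply sum_Rle. intros i _. apply Ht.
    - rewrite sum_plus. apply Rplus_le_compat; [apply b2|].
      apply (sum_geometric_le (1/2)). lra. }
  rewrite (sum_eq _ (fun i => tree_gauge (t i) * INR (length (l (S m))))) in T
    by (intros; ring).
  rewrite <- scal_sum in T.
  nra.
Qed.

(** Points of [P] within [sigma / 2] of one [z] are less than [sigma] apart, and so are their
    images; those images in [P] and [din t] thus lie in one class. The [length zs] resulting sets
    cost at most [2 * length zs / M_(m+1) <= 2 / n]. *)
Lemma tree_null (t : nat) (f : X -> X) :
  weak_contraction X d P f ->
  Hh_zero X d tree_gauge
    (fun y => P y /\ din t y /\ exists x, P x /\ dout t x /\ f x = y).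
Proof.
  intros Hf c Hc delta Hdel.
  destruct (rho_lim delta Hdel) as [N HN].
  destruct (INR_unbounded (2 / c)) as [n0 Hn0].
  (* The ratio [n] exceeds [2 / c], and [N <= n <= m] makes the level fine enough for [delta]. *)
  pose (n := (S n0 + N)%nat). pose (m := to_nat (t, n)).
  assert (nm : (n <= m)%nat) by (pose proof (to_nat_non_decreasing t n); unfold m; lia).
  specialize (HN (S m) ltac:(lia)).
  pose proof (rho_pos (S m)) as rp. pose proof (length_pos (S m)) as Lp.
  pose proof (Href m) as Rm. unfold m in Rm at 1 2 3.
  rewrite cancel_of_to in Rm. cbn [fst snd] in Rm.
  destruct Rm as [_ [_ [zs [sigma [Hz [Hout Hin]]]]]].
  pose (C := fun z y => P y /\ din t y /\ exists x, P x /\ d z x < sigma / 2 /\ f x = y).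
  assert (D : forall z, diam_le X d (C z) (rho (S m))).
  { intros z y y' [Py [iy [x [Px [zx e]]]]] [Py' [iy' [x' [Px' [zx' e']]]]].
    destruct (Hin y y' Py Py' iy iy') as [g|g]; [exact g|].
    destruct (classic (x = x')) as [->|ne].
    - rewrite <- e, <- e', metric_self by exact Hd; lra.
    - specialize (Hf x x' Px Px' ne). rewrite e, e' in Hf.
      pose proof (metric_tri X d Hd x z x'). rewrite (metric_sym X d Hd x z) in H. lra. }
  apply Hdelta_le_list with (Cs := map C zs);
    [exact tree_gauge_gauge|exact Hdel|..].
  - intros y [Py [iy [x [Px [ox e]]]]]. destruct (Hout x Px ox) as [z [iz zx]].
    exists (C z). split; [apply in_map; exact iz|]. split; [exact Py|split; [exact iy|eauto]].
  - intros K iK. apply in_map_iff in iK. destruct iK as [z [<- _]].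
    intros x y Cx Cy. apply Rle_trans with (1 := D z x y Cx Cy). lra.
  - rewrite lsum_map.
    apply Rle_trans with (INR (length zs) * (2 / INR (length (l (S m))))).
    + apply lsum_le_const. intros z _.
      apply Rle_trans with (2 := tree_gauge_rho (S m)).
      destruct (diam_bounds X d (C z) (rho (S m)) ltac:(lra) (D z)).
      apply tree_gauge_mono; auto.
    + apply le_INR in Hz. rewrite mult_INR in Hz.
      assert (n0n : INR n0 <= INR n) by (apply le_INR; unfold n; lia).
      assert (cn : 2 <= INR n * c).
      { apply Rmult_le_reg_r with (/ c); [apply Rinv_0_lt_compat; lra|].
        replace (INR n * c * / c) with (INR n) by (field; lra). unfold Rdiv in Hn0. lra. }
      apply Rmult_le_reg_r with (INR (length (l (S m)))); [lra|].
      replace (INR (length zs) * (2 / INR (length (l (S m)))) * INR (length (l (S m))))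
        with (INR (length zs) * 2) by (field; lra).
      pose proof (pos_INR (length zs)). nra.
Qed.

End Tree.

(** * The Hausdorff metric *)

(** A strict form of Hausdorff proximity, which avoids the minimum chosen in [dH]. *)
Definition near (X : Type) (d : X -> X -> R) (e : R) (A B : X -> Prop) : Prop :=
  (forall x, A x -> exists y, B y /\ d x y < e) /\
  (forall y, B y -> exists x, A x /\ d x y < e).

Section Hausdorff.
Variable X : Type.
Variable d : X -> X -> R.
Hypothesis Hd : is_metric X d.

Lemma near_trans e1 e2 A B C :
  near X d e1 A B -> near X d e2 B C -> near X d (e1 + e2) A C.
Proof.
  intros [ab ba] [bc cb]. split.
  - intros x Ax. destruct (ab x Ax) as [y [By xy]]. destruct (bc y By) as [z [Cz yz]].
    exists z; split; [exact Cz|]. pose proof (metric_tri X d Hd x y z). lra.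
  - intros z Cz. destruct (cb z Cz) as [y [By yz]]. destruct (ba y By) as [x [Ax xy]].
    exists x; split; [exact Ax|]. pose proof (metric_tri X d Hd x y z). lra.
Qed.

Lemma open_ball_open x e : Defs.open_set X d (fun y => d x y < e).
Proof.
  intros y Hy. exists (e - d x y). split; [lra|]. intros z yz.
  pose proof (metric_tri X d Hd x y z). lra.
Qed.

Lemma compact_net (K : X -> Prop) e : Defs.compact X d K -> 0 < e ->
  exists Z, (forall z, In z Z -> K z) /\ forall x, K x -> exists z, In z Z /\ d z x < e.
Proof.
  intros cK He.
  destruct (cK {z | K z} (fun z y => d (proj1_sig z) y < e)) as [L HL].
  - intros z. apply open_ball_open.
  - intros x Kx. exists (exist _ x Kx). simpl. rewrite metric_self by exact Hd. exact He.
  - exists (map (@proj1_sig _ _) L). split.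
    + intros z iz. apply in_map_iff in iz. destruct iz as [[y Ky] [<- _]]. exact Ky.
    + intros x Kx. destruct (HL x Kx) as [z [iz zx]].
      exists (proj1_sig z). split; [apply in_map; exact iz|exact zx].
Qed.

Lemma compact_bounded (K : X -> Prop) x0 : Defs.compact X d K ->
  exists B, 0 < B /\ forall x, K x -> d x0 x <= B.
Proof.
  intros cK. destruct (compact_net K 1 cK Rlt_0_1) as [Z [_ HZ]].
  (* Through reciprocals, a common small radius becomes an upper bound for finitely many
     distances. *)
  destruct (finite_radius (fun z e => d x0 z <= / e) Z) as [e [ep He]].
  { intros z _. pose proof (metric_pos X d Hd x0 z).
    exists (/ (d x0 z + 1)). split; [apply Rinv_0_lt_compat; lra|].
    intros e' [p le]. apply Rinv_le_contravar in le; [|exact p].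
    rewrite Rinv_inv in le. lra. }
  assert (0 < / e) by (apply Rinv_0_lt_compat; exact ep).
  exists (/ e + 1). split; [lra|]. intros x Kx. destruct (HZ x Kx) as [z [iz zx]].
  specialize (He e ltac:(lra) z iz). pose proof (metric_tri X d Hd x0 z x). lra.
Qed.

Lemma list_compact (F : list X) : F <> nil -> nonempty_compact X d (fun x => In x F).
Proof.
  intros ne. split; [destruct F as [|x F]; [tauto|exists x; left; auto]|].
  clear ne. intros I U oU. induction F as [|x F IH]; intros cov.
  - exists nil. intros x [].
  - destruct (cov x) as [i Ui]; [left; auto|].
    destruct IH as [L HL]; [intros; apply cov; right; auto|].
    exists (i :: L). intros y [<-|iy].
    + exists i; split; [left; auto|exact Ui].
    + destruct (HL y iy) as [j [ij Uj]]. exists j; split; [right; exact ij|exact Uj].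
Qed.

(** Boundedness of compact sets makes the infimum finite; it is attained because [Bset] allows an
    arbitrary slack. Completeness is applied to the negated radii. *)
Lemma dH_is_min (K1 K2 : KX X d) :
  is_min (dH_set X d (proj1_sig K1) (proj1_sig K2)) (dH X d K1 K2).
Proof.
  unfold dH. apply epsilon_spec.
  destruct K1 as [A [[a Aa] cA]], K2 as [B [[b Bb] cB]]; simpl.
  assert (pos : forall r, dH_set X d A B r -> 0 <= r).
  { intros r [s _]. apply Rnot_lt_le. intros neg.
    destruct (s a Aa (- r) ltac:(lra)) as [y [_ Hy]].
    pose proof (metric_pos X d Hd y a). lra. }
  destruct (completeness (fun y => dH_set X d A B (- y))) as [m [ub lub]].
  - exists 0. intros y Hy. specialize (pos _ Hy). lra.
  - destruct (compact_bounded A b cA) as [p [pp Hp]].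
    destruct (compact_bounded B a cB) as [q [qp Hq]].
    exists (- (p + q)). rewrite Ropp_involutive. split; intros x Hx e He.
    + exists b; split; [exact Bb|]. specialize (Hp x Hx). lra.
    + exists a; split; [exact Aa|]. specialize (Hq x Hx). lra.
  - exists (- m). split.
    + assert (ap : forall e, 0 < e -> exists r, dH_set X d A B r /\ r < - m + e).
      { intros e He. apply NNPP. intros none.
        assert (m <= m - e); [|lra].
        apply lub. intros y Hy. apply Rnot_lt_le. intros lt. apply none.
        exists (- y); split; [exact Hy|lra]. }
      split; intros x Hx e He; destruct (ap (e / 2) ltac:(lra)) as [r [[s1 s2] lt]].
      * destruct (s1 x Hx (e / 2) ltac:(lra)) as [y [By yx]]. exists y; split; [exact By|lra].
      * destruct (s2 x Hx (e / 2) ltac:(lra)) as [y [By yx]]. exists y; split; [exact By|lra].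
    + intros r Hr. assert (- r <= m); [|lra]. apply ub. now rewrite Ropp_involutive.
Qed.

Lemma near_of_dH (K1 K2 : KX X d) e :
  dH X d K1 K2 < e -> near X d e (proj1_sig K1) (proj1_sig K2).
Proof.
  intros lt. destruct (dH_is_min K1 K2) as [[s1 s2] _].
  split; intros x Hx.
  - destruct (s1 x Hx (e - dH X d K1 K2) ltac:(lra)) as [y [By yx]].
    exists y; split; [exact By|]. rewrite metric_sym by exact Hd. lra.
  - destruct (s2 x Hx (e - dH X d K1 K2) ltac:(lra)) as [y [By yx]].
    exists y; split; [exact By|lra].
Qed.

Lemma dH_of_near (K1 K2 : KX X d) e :
  near X d e (proj1_sig K1) (proj1_sig K2) -> dH X d K1 K2 <= e.
Proof.
  intros [n1 n2]. apply (dH_is_min K1 K2). split; intros x Hx eps He.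
  - destruct (n1 x Hx) as [y [By xy]]. exists y; split; [exact By|].
    rewrite metric_sym by exact Hd. lra.
  - destruct (n2 x Hx) as [y [By xy]]. exists y; split; [exact By|lra].
Qed.

Lemma nowhere_dense_of_dense_interior (G : KX X d -> Prop) :
  (forall K e, 0 < e -> exists K1, dH X d K K1 < e /\
     exists eta, 0 < eta /\ forall L, dH X d K1 L < eta -> G L) ->
  nowhere_dense X d (fun K => ~ G K).
Proof.
  intros H [K [e [ep He]]].
  destruct (H K e ep) as [K1 [c [eta [etap HG]]]].
  destruct (He K1 c eta etap) as [L [nG L1]]. apply nG, HG, L1.
Qed.

(** * Isolated points and the perfect part *)

Definition isolated (x : X) : Prop := exists r, 0 < r /\ forall y, d x y < r -> y = x.

(** The interior of the set of non-isolated points. The points neither isolated nor in it form the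
    boundary of the set of isolated points. *)
Definition perfect_at (x : X) : Prop :=
  exists r, 0 < r /\ forall y, d x y < r -> ~ isolated y.

Lemma isolated_open : Defs.open_set X d isolated.
Proof.
  intros x [r [rp Hr]]. exists r; split; [exact rp|].
  intros y xy. rewrite (Hr y xy). exists r; auto.
Qed.

Lemma perfect_at_open : Defs.open_set X d perfect_at.
Proof.
  intros x [r [rp Hr]]. exists (r / 2); split; [lra|]. intros y xy.
  exists (r / 2); split; [lra|]. intros z yz. apply Hr.
  pose proof (metric_tri X d Hd x y z). lra.
Qed.

Lemma perfect_not_isolated x : perfect_at x -> ~ isolated x.
Proof. intros [r [rp Hr]]. apply Hr. rewrite metric_self by exact Hd. exact rp. Qed.

Lemma isolated_or_perfect_dense x e : 0 < e ->
  exists y, d x y < e /\ (isolated y \/ perfect_at y).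
Proof.
  intros He. destruct (classic (exists y, d x y < e /\ isolated y)) as [[y [xy iy]]|none].
  - exists y; auto.
  - exists x. split; [rewrite metric_self by exact Hd; exact He|right].
    exists e; split; [exact He|]. intros y xy iy. apply none; eauto.
Qed.

(** * Adding new points in the perfect part *)

Lemma finite_separation (L : list X) :
  exists s, 0 < s /\ forall x y, In x L -> In y L -> x <> y -> s <= d x y.
Proof.
  destruct (finite_radius (fun x e => forall y, In y L -> x <> y -> e <= d x y) L)
    as [s [sp Hs]].
  - intros x _.
    destruct (finite_radius (fun y e => x <> y -> e <= d x y) L) as [s [sp Hs]].
    + intros y _. destruct (classic (x = y)) as [e|ne].
      * exists 1; split; [lra|]. intros; contradiction.
      * exists (d x y). split; [apply metric_lt_pos; auto|]. intros; lra.
    + exists s; split; [exact sp|]. intros e He y iy. apply (Hs e He y iy).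
  - exists s; split; [exact sp|]. intros x y ix. apply (Hs s ltac:(lra) x ix).
Qed.

Lemma perfect_new_point p tau L : perfect_at p -> 0 < tau ->
  exists w, d p w < tau /\ ~ In w L /\ perfect_at w.
Proof.
  intros pp tp.
  destruct (perfect_at_open p pp) as [r1 [r1p Hr1]].
  destruct (finite_separation (p :: L)) as [s [sp Hs]].
  pose (r := Rmin tau (Rmin r1 s)).
  assert (rp : 0 < r) by (repeat apply Rmin_glb_lt; auto).
  assert (r <= tau) by apply Rmin_l.
  assert (r <= Rmin r1 s) by apply Rmin_r.
  pose proof (Rmin_l r1 s). pose proof (Rmin_r r1 s).
  assert (E : exists w, d p w < r /\ w <> p).
  { apply NNPP. intros none. apply (perfect_not_isolated p pp).
    exists r; split; [exact rp|]. intros y py. apply NNPP. intros ne. apply none; eauto. }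
  destruct E as [w [pw ne]]. exists w. split; [lra|split].
  - intros iw. specialize (Hs p w (or_introl eq_refl) (or_intror iw)).
    assert (s <= d p w) by (apply Hs; auto). lra.
  - apply Hr1; lra.
Qed.

Lemma perfect_new_points p tau k L : perfect_at p -> 0 < tau ->
  exists W, length W = k /\ NoDup W /\
    forall w, In w W -> d p w < tau /\ ~ In w L /\ perfect_at w.
Proof.
  intros pp tp. induction k as [|k [W [lW [nd HW]]]].
  - exists nil. split; [reflexivity|split; [constructor|intros w []]].
  - destruct (perfect_new_point p tau (W ++ L) pp tp) as [w [pw [nw ww]]].
    exists (w :: W). split; [simpl; auto|split].
    + constructor; [|exact nd]. intros i; apply nw, in_or_app; auto.
    + intros v [<-|i]; [|auto]. split; [exact pw|split; [|exact ww]].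
      intros i; apply nw, in_or_app; auto.
Qed.

(** The clusters have radius [tau] and their centres are at least [rad + tau] apart, so a ball of
    radius [rad] sees only its own cluster. The clause [k p <> 0] lets a prescribed count of 0
    exclude a centre. *)
Lemma perfect_clusters (ps L : list X) (k : X -> nat) tau rad :
  0 < tau -> tau <= rad -> NoDup ps -> (forall p, In p ps -> perfect_at p) ->
  (forall p q, In p ps -> In q ps -> p <> q -> rad + tau <= d p q) ->
  exists W, NoDup W /\
    (forall w, In w W -> ~ In w L /\ perfect_at w /\
       exists p, In p ps /\ k p <> 0%nat /\ d p w < tau) /\
    forall p, In p ps -> cnt (fun x => d p x < rad) W = k p.
Proof.
  intros tp tr. induction ps as [|p ps IH]; intros nd pp far.
  - exists nil. split; [constructor|split; [intros w []|intros p []]].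
  - inversion_clear nd as [|? ? np nd'].
    destruct IH as [W [ndW [HW cW]]]; [exact nd'|intros; apply pp; right; auto
      |intros; apply far; auto; right; auto|].
    destruct (perfect_new_points p tau (k p) (W ++ L)) as [V [lV [ndV HV]]];
      [apply pp; left; auto|exact tp|].
    exists (V ++ W). split; [|split].
    + apply NoDup_app; auto. intros v iv iw. apply (HV v iv), in_or_app; auto.
    + intros w iw. apply in_app_or in iw. destruct iw as [iv|iw].
      * destruct (HV w iv) as [pw [nw ww]]. split; [intros i; apply nw, in_or_app; auto|].
        split; [exact ww|]. exists p; split; [left; auto|split; [|exact pw]].
        intros k0. rewrite k0 in lV. destruct V; [destruct iv|discriminate].
      * destruct (HW w iw) as [nw [ww [q [iq Hq]]]]. split; [exact nw|split; [exact ww|]].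
        exists q; split; [right; exact iq|exact Hq].
    + intros q [<-|iq]; rewrite cnt_app.
      * rewrite cnt_all, lV, cnt_none; [lia|..].
        -- intros w iw pw. destruct (HW w iw) as [_ [_ [q [iq [_ qw]]]]].
           assert (rad + tau <= d p q).
           { apply far; [left; auto|right; auto|]. intros ->; contradiction. }
           pose proof (metric_tri X d Hd p w q). rewrite (metric_sym X d Hd w q) in *. lra.
        -- intros v iv. destruct (HV v iv). lra.
      * rewrite (cW q iq), cnt_none; [lia|].
        intros v iv qv. destruct (HV v iv) as [pv _].
        assert (rad + tau <= d p q).
        { apply far; [left; auto|right; auto|]. intros ->; contradiction. }
        pose proof (metric_tri X d Hd p v q). rewrite (metric_sym X d Hd v q) in *. lra.
Qed.

End Hausdorff.

(** * Density of the refinement property *)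

Section Genericity.
Variable X : Type.
Variable d : X -> X -> R.
Hypothesis Hd : is_metric X d.
Local Notation isolated := (isolated X d).
Local Notation perfect_at := (perfect_at X d).

(** An enumeration of the positive rationals, which keeps the number of exceptional sets
    countable. *)
Definition scale (i : nat) : R := (INR (fst (of_nat i)) + 1) / (INR (snd (of_nat i)) + 1).

Lemma scale_small e : 0 < e -> exists i, 0 < scale i <= e.
Proof.
  intros He. destruct (INR_unbounded (/ e)) as [n Hn].
  exists (to_nat (0%nat, n)). unfold scale. rewrite cancel_of_to. cbn [fst snd INR].
  pose proof (pos_INR n). split; [apply Rdiv_lt_0_compat; lra|].
  apply Rmult_le_reg_r with (INR n + 1); [lra|].
  replace ((0 + 1) / (INR n + 1) * (INR n + 1)) with 1 by (field; lra).
  apply (Rmult_lt_compat_l e) in Hn; [|exact He]. rewrite Rinv_r in Hn; lra.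
Qed.

Lemma scale_large b : exists i, 0 < scale i /\ b <= scale i.
Proof.
  destruct (INR_unbounded b) as [n Hn].
  exists (to_nat (n, 0%nat)). unfold scale. rewrite cancel_of_to. cbn [fst snd INR].
  pose proof (pos_INR n). split; lra.
Qed.

(** The new level has its scale in the same countable family, so the step can be repeated. *)
Definition good (din dout : X -> Prop) (n i : nat) (K : X -> Prop) : Prop :=
  (forall x, K x -> isolated x \/ perfect_at x) /\
  forall r l, level X d (fun x => K x /\ perfect_at x) (scale i) r l ->
    exists i' r' l',
      level X d (fun x => K x /\ perfect_at x) (scale i') r' l' /\
      refines X d (fun x => K x /\ perfect_at x) din dout n (scale i) l (scale i') r' l'.

(* [F] consists of a net [Z] of [T] and of new points, equally many in each class in total.
   Near [din] they are added first; then those away from [din] are put in balls so small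
   that they do not increase the number of sets needed to cover [dout] at the scale on
   which the points near [din] are separated. *)
Lemma good_near_level (T din dout : X -> Prop) (g e : R) (n i : nat) r0 l0 :
  Defs.compact X d T -> (forall x, T x -> isolated x \/ perfect_at x) ->
  level X d (fun x => T x /\ perfect_at x) (scale i) r0 l0 ->
  0 < g -> (forall x y, din x -> dout y -> g <= d x y) -> 0 < e ->
  exists F, F <> nil /\ near X d e T (fun x => In x F) /\
    exists eta, 0 < eta /\
      forall K, near X d eta (fun x => In x F) K -> good din dout n i K.
Proof.
  intros cT Tip L0 gp gap ep. set (rho := scale i) in *.
  pose proof L0 as [rhop [r4 [_ [ne0 [nd0 [l0T [cov0 [gap0 rep0]]]]]]]].
  destruct (compact_net X d Hd T (e / 2) cT ltac:(lra)) as [N [NT HN]].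
  assert (dec : forall x y : X, {x = y} + {x <> y})
    by (intros x y; destruct (excluded_middle_informative (x = y)); auto).
  pose (Z := nodup dec (l0 ++ N)).
  assert (ndZ : NoDup Z) by apply NoDup_nodup.
  assert (l0Z : forall p, In p l0 -> In p Z).
  { intros p ip. apply nodup_In, in_or_app; auto. }
  assert (ZT : forall z, In z Z -> T z).
  { intros z iz. apply nodup_In, in_app_or in iz. destruct iz as [iz|iz]; [|auto].
    apply (l0T z iz). }
  pose (pb := fun x => if excluded_middle_informative (perfect_at x) then true else false).
  assert (Hpb : forall x, pb x = true <-> perfect_at x).
  { intros x. unfold pb. destruct (excluded_middle_informative (perfect_at x));
      split; intros; auto; discriminate || contradiction. }
  pose (ZY := filter pb Z).
  assert (HZY : forall z, In z ZY <-> In z Z /\ perfect_at z).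
  { intros z. unfold ZY. rewrite filter_In, Hpb. tauto. }
  (* The target number of points per class: the first term gives the ratio [n], the second ensures
     [c p <= a], and 2 gives at least two children. *)
  pose (a := (n * length Z + length Z + 2)%nat).
  pose (inner := fun p => exists y, din y /\ d p y < g / 2).
  pose (c := fun p => cnt (fun x => d p x < 2 * rho) ZY).
  assert (ca : forall p, (c p <= a)%nat).
  { intros p. unfold c, a. pose proof (cnt_le_length (fun x => d p x < 2 * rho) ZY).
    assert (length ZY <= length Z)%nat by apply filter_length_le. nia. }
  pose (tau := Rmin (e / 2) (Rmin (rho / 8) (g / 8))).
  assert (tau1 : tau <= e / 2) by apply Rmin_l.
  assert (tau' : tau <= Rmin (rho / 8) (g / 8)) by apply Rmin_r.
  pose proof (Rmin_l (rho / 8) (g / 8)). pose proof (Rmin_r (rho / 8) (g / 8)).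
  assert (taup : 0 < tau) by (repeat apply Rmin_glb_lt; lra).
  assert (far : forall t, t <= tau -> forall p q, In p l0 -> In q l0 -> p <> q ->
    2 * rho + t <= d p q).
  { intros t tt p q ip iq ne. destruct (gap0 p q (l0T p ip) (l0T q iq)) as [k|k]; [|lra].
    destruct ne; apply rep0; auto. }
  assert (l0perf : forall p, In p l0 -> perfect_at p) by (intros p ip; apply (l0T p ip)).
  destruct (perfect_clusters X d Hd l0 Z
    (fun p => if excluded_middle_informative (inner p) then (a - c p)%nat else 0%nat)
    tau (2 * rho) taup ltac:(lra) nd0 l0perf (far tau (Rle_refl tau)))
    as [W1 [ndW1 [HW1 cW1]]].
  (* The separation near [din] is fixed here, before the points of [W2] are placed; [sigma] will be
     [s1 / 2]. *)
  destruct (finite_separation X d Hd (Z ++ W1)) as [s1 [s1p Hs1]].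
  pose (tau2 := Rmin tau (s1 / 8)).
  assert (tau21 : tau2 <= tau) by apply Rmin_l.
  assert (tau22 : tau2 <= s1 / 8) by apply Rmin_r.
  assert (tau2p : 0 < tau2) by (apply Rmin_glb_lt; lra).
  destruct (perfect_clusters X d Hd l0 (Z ++ W1)
    (fun p => if excluded_middle_informative (inner p) then 0%nat else (a - c p)%nat)
    tau2 (2 * rho) tau2p ltac:(lra) nd0 l0perf (far tau2 tau21))
    as [W2 [ndW2 [HW2 cW2]]].
  assert (HW1' : forall w, In w W1 ->
    ~ In w Z /\ perfect_at w /\ exists p, In p l0 /\ inner p /\ d p w < tau).
  { intros w iw. destruct (HW1 w iw) as [u [v [p [ip [k pw]]]]].
    split; [exact u|split; [exact v|]]. exists p. split; [exact ip|split; [|exact pw]].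
    destruct (excluded_middle_informative (inner p)); [auto|tauto]. }
  assert (HW2' : forall w, In w W2 ->
    ~ In w (Z ++ W1) /\ perfect_at w /\ exists p, In p l0 /\ ~ inner p /\ d p w < tau2).
  { intros w iw. destruct (HW2 w iw) as [u [v [p [ip [k pw]]]]].
    split; [exact u|split; [exact v|]]. exists p. split; [exact ip|split; [|exact pw]].
    destruct (excluded_middle_informative (inner p)); [tauto|auto]. }
  clear HW1 HW2.
  pose (FY := ZY ++ W1 ++ W2). pose (F := Z ++ W1 ++ W2).
  assert (FYF : forall f, In f FY <-> In f F /\ perfect_at f).
  { intros f. unfold FY, F. rewrite !in_app_iff, HZY. split; [|tauto].
    intros [k|[k|k]]; [tauto|..].
    - split; [auto|apply (HW1' f k)].
    - split; [auto|apply (HW2' f k)]. }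
  assert (ndFY : NoDup FY).
  { unfold FY. apply NoDup_app; [apply NoDup_filter; exact ndZ|apply NoDup_app; auto|].
    - intros w i1 i2. apply (HW2' w i2), in_or_app; auto.
    - intros w iz iw. apply HZY in iz. apply in_app_or in iw. destruct iw as [iw|iw].
      + apply (HW1' w iw), iz.
      + apply (HW2' w iw), in_or_app; left; apply iz. }
  assert (cFY : forall p, In p l0 -> cnt (fun x => d p x < 2 * rho) FY = a).
  { intros p ip. unfold FY. rewrite !cnt_app, (cW1 p ip), (cW2 p ip). fold (c p).
    specialize (ca p). destruct (excluded_middle_informative (inner p)); lia. }
  assert (host : forall f, In f FY -> exists z, (T z /\ perfect_at z) /\ d z f < tau).
  { intros f iF. unfold FY in iF. rewrite !in_app_iff in iF. destruct iF as [k|[k|k]].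
    - exists f. apply HZY in k. rewrite metric_self by exact Hd.
      split; [split; [apply ZT|]; apply k|exact taup].
    - destruct (HW1' f k) as [_ [_ [p [ip [_ pf]]]]]. exists p; split; auto.
    - destruct (HW2' f k) as [_ [_ [p [ip [_ pf]]]]]. exists p; split; [auto|lra]. }
  assert (l0FY : forall p, In p l0 -> In p FY).
  { intros p ip. apply FYF. split; [apply in_or_app; left; auto|auto]. }
  (* Points of [FY] are within [rho / 8] of the perfect part of [T], whose distances avoid the
     interval from [rho] to [4 * rho]. Hence balls of radius [2 * rho] count classes. *)
  assert (dich : forall f f', In f FY -> In f' FY -> d f f' < 5/4 * rho \/ 15/4 * rho < d f f').
  { intros f f' iF iF'.
    destruct (host f iF) as [z [Pz zf]]. destruct (host f' iF') as [z' [Pz' zf']].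
    pose proof (metric_tri X d Hd f z f'). pose proof (metric_tri X d Hd z z' f').
    pose proof (metric_tri X d Hd z f z'). pose proof (metric_tri X d Hd f f' z').
    rewrite (metric_sym X d Hd f z), (metric_sym X d Hd f' z') in *.
    destruct (gap0 z z' Pz Pz'); [left|right]; lra. }
  assert (root : forall f, In f FY -> exists p, In p l0 /\ d p f < 5/4 * rho).
  { intros f iF. destruct (host f iF) as [z [Pz zf]]. destruct (cov0 z Pz) as [p [ip pz]].
    exists p; split; [exact ip|]. pose proof (metric_tri X d Hd p z f). lra. }
  destruct (finite_separation X d Hd F) as [s2 [s2p Hs2]].
  (* Within [e0] of [F], a point near a perfect one is perfect and a point near an isolated one
     equals it. *)
  destruct (finite_radius (fun f t => (perfect_at f -> forall y, d f y < t -> perfect_at y) /\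
    (~ perfect_at f -> forall y, d f y < t -> y = f)) F) as [e0 [e0p He0]].
  { intros f iF. destruct (classic (perfect_at f)) as [pf|npf].
    - destruct (perfect_at_open X d Hd f pf) as [t [tp Ht]]. exists t; split; [exact tp|].
      intros t' Ht'. split; [|tauto]. intros _ y Hy. apply Ht; lra.
    - assert (Tf : T f).
      { unfold F in iF. rewrite !in_app_iff in iF. destruct iF as [k|[k|k]]; [auto|..].
        - destruct npf; apply (HW1' f k).
        - destruct npf; apply (HW2' f k). }
      destruct (Tip f Tf) as [[t [tp Ht]]|pf]; [|contradiction].
      exists t; split; [exact tp|]. intros t' Ht'. split; [tauto|].
      intros _ y Hy. apply Ht; lra. }
  specialize (He0 e0 ltac:(lra)).
  exists F. split; [|split].
  { destruct l0 as [|p l0']; [tauto|]. intros E.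
    assert (In p F) as k by (apply in_or_app; left; apply l0Z; left; auto).
    rewrite E in k; destruct k. }
  { split.
    - intros x Tx. destruct (HN x Tx) as [z [iz zx]]. exists z. split.
      + apply in_or_app; left. apply nodup_In, in_or_app; auto.
      + rewrite metric_sym by exact Hd. lra.
    - intros f iF. destruct (classic (In f FY)) as [iY|nY].
      + destruct (host f iY) as [z [[Tz _] zf]]. exists z; split; [exact Tz|lra].
      + exists f. rewrite metric_self by exact Hd. split; [|exact ep].
        unfold F in iF. unfold FY in nY. rewrite !in_app_iff in iF, nY.
        apply ZT. tauto. }
  pose (r' := Rmin rho (s2 / 2)).
  assert (r'1 : r' <= rho) by apply Rmin_l.
  assert (r'2 : r' <= s2 / 2) by apply Rmin_r.
  assert (r'p : 0 < r') by (apply Rmin_glb_lt; lra).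
  pose proof (pos_INR (length FY)) as lenp.
  (* The denominator yields both [4 * rho' <= r'] and [rho' * length FY <= r']. *)
  destruct (scale_small (r' / (INR (length FY) + 4))) as [i' [ip' ile]];
    [apply Rdiv_lt_0_compat; lra|].
  set (rho' := scale i') in *.
  assert (ile' : rho' * (INR (length FY) + 4) <= r').
  { apply Rmult_le_reg_r with (/ (INR (length FY) + 4)); [apply Rinv_0_lt_compat; lra|].
    replace (rho' * (INR (length FY) + 4) * / (INR (length FY) + 4)) with rho'
      by (field; lra). exact ile. }
  assert (ile4 : 4 * rho' <= r') by nra.
  pose (eta := Rmin (rho' / 2) (Rmin e0 (Rmin (s1 / 8) tau))).
  assert (E1 : eta <= rho' / 2) by apply Rmin_l.
  assert (E2 : eta <= Rmin e0 (Rmin (s1 / 8) tau)) by apply Rmin_r.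
  pose proof (Rmin_l e0 (Rmin (s1 / 8) tau)). pose proof (Rmin_r e0 (Rmin (s1 / 8) tau)).
  pose proof (Rmin_l (s1 / 8) tau). pose proof (Rmin_r (s1 / 8) tau).
  assert (etap : 0 < eta) by (repeat apply Rmin_glb_lt; lra).
  exists eta. split; [exact etap|].
  intros K [FK KF].
  assert (KY : forall x, K x /\ perfect_at x -> exists f, In f FY /\ d f x < eta).
  { intros x [Kx px]. destruct (KF x Kx) as [f [iF fx]]. exists f; split; [|exact fx].
    apply FYF; split; [exact iF|]. apply NNPP. intros npf.
    assert (x = f) by (apply (He0 f iF); [exact npf|lra]). subst; contradiction. }
  assert (sepK : forall f f' x y, In f FY -> In f' FY -> f <> f' -> d f x < eta -> d f' y < eta ->
    s2 / 2 <= d x y).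
  { intros f f' x y iF iF' ne fx fy. apply FYF in iF; apply FYF in iF'.
    pose proof (Hs2 f f' (proj1 iF) (proj1 iF') ne).
    pose proof (metric_tri X d Hd f x f'). pose proof (metric_tri X d Hd x y f').
    rewrite (metric_sym X d Hd y f') in *. lra. }
  split.
  { intros x Kx. destruct (KF x Kx) as [f [iF fx]].
    destruct (classic (perfect_at f)) as [pf|npf].
    - right. apply (He0 f iF); [exact pf|lra].
    - left. assert (x = f) by (apply (He0 f iF); [exact npf|lra]). subst x.
      apply NNPP. intros ni. apply npf.
      assert (Tf : T f); [|destruct (Tip f Tf); tauto].
      unfold F in iF. rewrite !in_app_iff in iF. destruct iF as [k|[k|k]]; [auto|..].
      + destruct npf; apply (HW1' f k).
      + destruct npf; apply (HW2' f k). }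
  intros r l L. fold rho in L |- *.
  assert (Ech : forall f, exists x, In f FY -> (K x /\ perfect_at x) /\ d f x < eta).
  { intros f. destruct (classic (In f FY)) as [iY|nY].
    - apply FYF in iY. destruct iY as [iF pf]. destruct (FK f iF) as [x [Kx fx]].
      exists x. intros _. split; [split; [exact Kx|]|exact fx].
      apply (He0 f iF); [exact pf|lra].
    - exists f; tauto. }
  destruct (choice _ Ech) as [pt Hpt]. clear Ech.
  pose proof L as [_ [r4' [_ [_ [_ [lK [_ [gapK _]]]]]]]].
  assert (pe : forall f, In f FY -> d f (pt f) < eta) by (intros f iF; apply Hpt; exact iF).
  (* The level [l] of [K] is arbitrary, so its classes are matched with those of [l0]: [p] is close
     to some [f0] in [FY], which lies in the class of some [p0] in [l0]. *)
  assert (cl' : forall p, In p l -> cnt (fun q => d p q <= rho) (map pt FY) = a).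
  { intros p ip. rewrite cnt_map.
    destruct (KY p (lK p ip)) as [f0 [iF0 f0p]]. destruct (root f0 iF0) as [p0 [ip0 p0f0]].
    rewrite <- (cFY p0 ip0). apply cnt_ext. intros f iF.
    pose proof (pe f iF) as fpt. pose proof (proj1 (Hpt f iF)) as Kpt.
    pose proof (metric_tri X d Hd f0 p f). pose proof (metric_tri X d Hd p (pt f) f).
    pose proof (metric_tri X d Hd p f0 (pt f)). pose proof (metric_tri X d Hd f0 f (pt f)).
    pose proof (metric_tri X d Hd p0 f0 f). pose proof (metric_tri X d Hd f0 p0 f).
    rewrite (metric_sym X d Hd (pt f) f), (metric_sym X d Hd p f0), (metric_sym X d Hd f0 p0) in *.
    split; intros k.
    - destruct (dich p0 f (l0FY p0 ip0) iF); lra.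
    - destruct (dich p0 f (l0FY p0 ip0) iF); [|lra].
      destruct (dich f0 f iF0 iF); [|lra].
      destruct (gapK p (pt f) (lK p ip) Kpt); lra. }
  exists i', r', (map pt FY). fold rho'. split.
  - assert (inj : forall f f', In f FY -> In f' FY -> d (pt f) (pt f') <= rho' -> f = f').
    { intros f f' iF iF' k. apply NNPP. intros ne.
      pose proof (sepK f f' _ _ iF iF' ne (pe f iF) (pe f' iF')). lra. }
    split; [exact ip'|]. split; [exact ile4|].
    split; [|split; [|split; [|split; [|split; [|split]]]]].
    + rewrite length_map. nra.
    + intros E. apply map_eq_nil in E. destruct l0 as [|p l0']; [tauto|].
      specialize (l0FY p (or_introl eq_refl)). rewrite E in l0FY; destruct l0FY.
    + apply NoDup_map_NoDup_ForallPairs; [|exact ndFY]. intros f f' iF iF' E. apply inj; auto.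
      rewrite E, metric_self by exact Hd; lra.
    + intros p ip. apply in_map_iff in ip. destruct ip as [f [<- iF]]. apply Hpt; exact iF.
    + intros x Kx. destruct (KY x Kx) as [f [iF fx]]. exists (pt f).
      split; [apply in_map; exact iF|]. pose proof (metric_tri X d Hd (pt f) f x).
      rewrite (metric_sym X d Hd (pt f) f) in *. specialize (pe f iF). lra.
    + intros x y Kx Ky. destruct (KY x Kx) as [f [iF fx]]. destruct (KY y Ky) as [f' [iF' fy]].
      destruct (classic (f = f')) as [<-|ne].
      * left. pose proof (metric_tri X d Hd x f y). rewrite (metric_sym X d Hd x f) in *. lra.
      * right. pose proof (sepK f f' x y iF iF' ne fx fy). lra.
    + intros p q ip iq. apply in_map_iff in ip; apply in_map_iff in iq.
      destruct ip as [f [<- iF]], iq as [f' [<- iF']]. intros k. f_equal. apply inj; auto.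
  - split; [exact r'1|]. split; [exists a; split; [unfold a; lia|exact cl']|].
    exists Z, (s1 / 2). split; [|split].
    (* A single class already contains [a >= n * length Z] of the new points. *)
    + destruct l as [|p l'].
      { destruct L as [_ [_ [_ [k _]]]]. tauto. }
      pose proof (cl' p (or_introl eq_refl)) as E.
      pose proof (cnt_le_length (fun q => d p q <= rho) (map pt FY)). unfold a in E. lia.
    + intros x Kx ox. destruct (KY x Kx) as [f [iF fx]].
      unfold FY in iF. rewrite !in_app_iff in iF. destruct iF as [k|[k|k]].
      * exists f; split; [apply HZY; exact k|lra].
      * exfalso. destruct (HW1' f k) as [_ [_ [p [_ [[y [iy py]] pf]]]]].
        pose proof (gap y x iy ox). pose proof (metric_tri X d Hd y p x).
        pose proof (metric_tri X d Hd p f x). rewrite (metric_sym X d Hd y p) in *. lra.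
      (* The centre [p] belongs to [Z], and [tau2 + eta <= s1 / 4 = sigma / 2]. *)
      * destruct (HW2' f k) as [_ [_ [p [ip [_ pf]]]]]. exists p; split; [auto|].
        pose proof (metric_tri X d Hd p f x). lra.
    + assert (Z1 : forall y f, In f FY -> d f y < eta -> din y -> In f (Z ++ W1)).
      { intros y f iF fy iy. unfold FY in iF. rewrite !in_app_iff in *.
        destruct iF as [k|[k|k]]; [left; apply HZY; exact k|right; exact k|].
        exfalso. destruct (HW2' f k) as [_ [_ [p [_ [np pf]]]]].
        apply np. exists y; split; [exact iy|]. pose proof (metric_tri X d Hd p f y). lra. }
      intros y y' Ky Ky' iy iy'.
      destruct (KY y Ky) as [f [iF fy]]. destruct (KY y' Ky') as [f' [iF' fy']].
      pose proof (Z1 y f iF fy iy) as zf. pose proof (Z1 y' f' iF' fy' iy') as zf'.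
      destruct (classic (f = f')) as [<-|ne].
      * left. pose proof (metric_tri X d Hd y f y'). rewrite (metric_sym X d Hd y f) in *. lra.
      * right. pose proof (Hs1 f f' zf zf' ne).
        pose proof (metric_tri X d Hd f y f'). pose proof (metric_tri X d Hd y y' f').
        rewrite (metric_sym X d Hd y' f') in *. lra.
Qed.

Lemma finite_approximation (K : X -> Prop) e :
  (exists x, K x) -> Defs.compact X d K -> 0 < e ->
  exists F, F <> nil /\ near X d e K (fun x => In x F) /\
    forall f, In f F -> isolated f \/ perfect_at f.
Proof.
  intros [x0 Kx0] cK ep.
  destruct (compact_net X d Hd K (e / 2) cK ltac:(lra)) as [Z [ZK HZ]].
  destruct (choice _ (fun z => isolated_or_perfect_dense X d Hd z (e / 2) ltac:(lra)))
    as [pt Hpt].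
  exists (map pt Z). split; [|split; [split|]].
  - intros E. apply map_eq_nil in E. destruct (HZ x0 Kx0) as [z [iz _]].
    rewrite E in iz; destruct iz.
  - intros x Kx. destruct (HZ x Kx) as [z [iz zx]]. exists (pt z).
    split; [apply in_map; exact iz|]. pose proof (metric_tri X d Hd x z (pt z)).
    rewrite (metric_sym X d Hd x z) in *. destruct (Hpt z). lra.
  - intros f iF. apply in_map_iff in iF. destruct iF as [z [<- iz]].
    exists z; split; [auto|]. destruct (Hpt z). lra.
  - intros f iF. apply in_map_iff in iF. destruct iF as [z [<- _]]. apply Hpt.
Qed.

(** Either some set near [K] avoids the boundary and has a level at scale [i], and [good_near_level]
    applies to it; or no such set exists, and around a finite approximation off the boundary the
    refinement condition holds vacuously. *)
Lemma good_dense_interior (din dout : X -> Prop) (g : R) (n i : nat) (K : KX X d) e :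
  0 < g -> (forall x y, din x -> dout y -> g <= d x y) -> 0 < e ->
  exists K1, dH X d K K1 < e /\ exists eta, 0 < eta /\
    forall L, dH X d K1 L < eta -> good din dout n i (proj1_sig L).
Proof.
  intros gp gap ep.
  destruct (classic (exists T : KX X d, dH X d K T < e / 2 /\
    (forall x, proj1_sig T x -> isolated x \/ perfect_at x) /\
    exists r l, level X d (fun x => proj1_sig T x /\ perfect_at x) (scale i) r l))
    as [[T [KT [Tip [r [l L]]]]]|none].
  - destruct (good_near_level (proj1_sig T) din dout g (e / 4) n i r l
      (proj2 (proj2_sig T)) Tip L gp gap ltac:(lra)) as [F [ne [nF [eta [etap HF]]]]].
    exists (exist _ _ (list_compact X d F ne)). split.
    + apply Rle_lt_trans with (e / 2 + e / 4); [|lra].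
      apply dH_of_near; [exact Hd|].
      apply near_trans with (2 := near_of_dH X d Hd K T _ KT) (3 := nF). exact Hd.
    + exists eta; split; [exact etap|]. intros M HM. apply HF.
      apply (near_of_dH X d Hd _ _ _ HM).
  - destruct (finite_approximation (proj1_sig K) (e / 4) (proj1 (proj2_sig K))
      (proj2 (proj2_sig K)) ltac:(lra)) as [F [ne [nF Fip]]].
    destruct (finite_radius (fun f t => forall y, d f y < t -> isolated y \/ perfect_at y) F)
      as [t [tp Ht]].
    { intros f iF. destruct (Fip f iF) as [k|k].
      - destruct (isolated_open X d f k) as [t [tp Ht]]. exists t; split; [exact tp|].
        intros t' Ht' y fy. left; apply Ht; lra.
      - destruct (perfect_at_open X d Hd f k) as [t [tp Ht]]. exists t; split; [exact tp|].
        intros t' Ht' y fy. right; apply Ht; lra. }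
    exists (exist _ _ (list_compact X d F ne)). split.
    + apply Rle_lt_trans with (e / 4); [|lra]. apply dH_of_near; [exact Hd|exact nF].
    + exists (Rmin t (e / 8)). split; [apply Rmin_glb_lt; lra|]. intros M HM.
      pose proof (Rmin_l t (e / 8)). pose proof (Rmin_r t (e / 8)).
      pose proof (near_of_dH X d Hd _ _ _ HM) as nM. simpl in nM.
      assert (Mip : forall x, proj1_sig M x -> isolated x \/ perfect_at x).
      { intros x Mx. destruct (proj2 nM x Mx) as [f [iF fx]].
        apply (Ht t ltac:(lra) f iF). lra. }
      split; [exact Mip|]. intros r l L. exfalso. apply none. exists M.
      split; [|split; [exact Mip|eauto]].
      apply Rle_lt_trans with (e / 4 + Rmin t (e / 8)); [|lra].
      apply dH_of_near; [exact Hd|].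
      apply near_trans with (2 := nF) (3 := nM). exact Hd.
Qed.

(** * From the refinement property to the gauge *)

Lemma compact_isolated_part_finite (K : X -> Prop) :
  Defs.compact X d K -> (forall x, K x -> isolated x \/ perfect_at x) ->
  exists F, forall x, K x -> perfect_at x \/ In x F.
Proof.
  intros cK Kip.
  destruct (cK X (fun i y => perfect_at y \/ (y = i /\ isolated i))) as [F HF].
  - intros i y [py|[-> ii]].
    + destruct (perfect_at_open X d Hd y py) as [r [rp Hr]]. exists r; split; auto.
    + pose proof ii as [r [rp Hr]]. exists r; split; [exact rp|]. intros z iz. right; auto.
  - intros x Kx. exists x. destruct (Kip x Kx); auto.
  - exists F. intros x Kx. destruct (HF x Kx) as [i [iF [k|[-> _]]]]; auto.
Qed.

Lemma good_tree (K : X -> Prop) (din dout : nat -> X -> Prop) :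
  Defs.compact X d K -> (exists x, K x /\ perfect_at x) ->
  (forall t n i, good (din t) (dout t) n i K) ->
  exists (rho r : nat -> R) (l : nat -> list X),
    (forall m, level X d (fun x => K x /\ perfect_at x) (rho m) (r m) (l m)) /\
    forall m, refines X d (fun x => K x /\ perfect_at x)
      (din (fst (of_nat m))) (dout (fst (of_nat m))) (snd (of_nat m))
      (rho m) (l m) (rho (S m)) (r (S m)) (l (S m)).
Proof.
  intros cK [x0 Px0] HG. set (P := fun x => K x /\ perfect_at x) in *.
  pose (lev := fun s : nat * (R * list X) =>
    level X d P (scale (fst s)) (fst (snd s)) (snd (snd s))).
  pose (ref := fun m (s s' : nat * (R * list X)) =>
    refines X d P (din (fst (of_nat m))) (dout (fst (of_nat m))) (snd (of_nat m))
      (scale (fst s)) (snd (snd s)) (scale (fst s')) (fst (snd s')) (snd (snd s'))).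
  assert (St : forall ms : nat * (nat * (R * list X)), exists s',
    lev (snd ms) -> lev s' /\ ref (fst ms) (snd ms) s').
  { intros [m s]. simpl. destruct (classic (lev s)) as [Ls|nL]; [|exists s; tauto].
    destruct (HG (fst (of_nat m)) (snd (of_nat m)) (fst s)) as [_ G].
    destruct (G _ _ Ls) as [i' [r' [l' [L' R']]]]. exists (i', (r', l')). auto. }
  destruct (choice _ St) as [next Hnext].
  (* The initial level is a single class: its scale exceeds the diameter bound [2 * B] of [K] or
     equals it. *)
  assert (I : exists s, lev s).
  { destruct (compact_bounded X d Hd K x0 cK) as [B [Bp HB]].
    destruct (scale_large (2 * B)) as [i [ip iB]].
    exists (i, (4 * scale i, x0 :: nil)). unfold lev, level. cbn [fst snd length INR].
    split; [exact ip|]. split; [lra|]. split; [lra|]. split; [discriminate|].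
    split; [constructor; [intros []|constructor]|]. split; [intros p [<-|[]]; exact Px0|].
    split; [|split].
    - intros x [Kx _]. exists x0; split; [left; auto|]. specialize (HB x Kx). lra.
    - intros x y [Kx _] [Ky _]. left. pose proof (metric_tri X d Hd x x0 y).
      rewrite (metric_sym X d Hd x x0) in *. pose proof (HB x Kx). pose proof (HB y Ky). lra.
    - intros p q [<-|[]] [<-|[]]; auto. }
  destruct I as [s0 L0].
  pose (s := nat_rect (fun _ => (nat * (R * list X))%type) s0 (fun m sm => next (m, sm))).
  assert (Ls : forall m, lev (s m)).
  { induction m as [|m IH]; [exact L0|]. apply (Hnext (m, s m) IH). }
  exists (fun m => scale (fst (s m))), (fun m => fst (snd (s m))), (fun m => snd (snd (s m))).
  split; [exact Ls|]. intros m. exact (proj2 (Hnext (m, s m) (Ls m))).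
Qed.

Lemma good_conclusion (K : X -> Prop) (din dout : nat -> X -> Prop) :
  nonempty_compact X d K ->
  (forall x y, x <> y -> exists t, din t y /\ dout t x) ->
  (forall t n i, good (din t) (dout t) n i K) ->
  finite_set X K \/
  exists h, gauge h /\ continuous_on_nonneg h /\ Hh_pos_finite X d h K /\
    forall f, weak_contraction X d K f -> Hh_zero X d h (fun y => K y /\ Defs.image X f K y).
Proof.
  intros [_ cK] sep HG.
  pose proof (proj1 (HG 0%nat 0%nat 0%nat)) as Kip.
  destruct (compact_isolated_part_finite K cK Kip) as [F HF].
  destruct (classic (exists x, K x /\ perfect_at x)) as [ne|none].
  2:{ left. exists F. intros x Kx. destruct (HF x Kx) as [k|k]; [|exact k].
      destruct none; eauto. }
  right. destruct (good_tree K din dout cK ne HG) as [rho [r [l [Hlev Href]]]].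
  set (P := fun x => K x /\ perfect_at x) in *.
  pose proof (tree_gauge_gauge X d Hd P rho r l din dout Hlev Href) as Hh.
  exists (tree_gauge X rho l). split; [exact Hh|]. split; [|split; [split|]].
  - exact (tree_gauge_continuous X d Hd P rho r l din dout Hlev Href).
  - apply (tree_positive X d Hd P rho r l din dout Hlev Href K isolated); auto.
    + intros x Px; apply Px.
    + exact (isolated_open X d).
    + intros x [_ px]. exact (perfect_not_isolated X d Hd x px).
    + intros x Kx. unfold P. destruct (Kip x Kx); auto.
  - exists 2. apply (tree_Hh_le X d Hd P rho r l din dout Hlev Href K F).
    intros x Kx. unfold P. destruct (HF x Kx); auto.
  - intros f Hf.
    assert (HfP : weak_contraction X d P f).
    { intros x y Px Py. apply Hf; [apply Px|apply Py]. }
    assert (Hfix : exists p, forall x, K x -> f x = x -> x = p).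
    { destruct (classic (exists p, K p /\ f p = p)) as [[p [Kp fp]]|nofix].
      - exists p. intros x Kx fx. apply NNPP. intros nxp.
        specialize (Hf x p Kx Kp nxp). rewrite fx, fp in Hf. lra.
      - destruct ne as [x0 _]. exists x0. intros x Kx fx. destruct nofix; eauto. }
    destruct Hfix as [p Hp].
    (* Index 0 collects the possible fixed point, [F] and its image; index [S t] treats the pair of
       regions [t]. *)
    apply Hh_zero_mono with (B := fun y => exists k, match k with
      | 0 => fun y => In y (p :: F ++ map f F)
      | S t => fun y => P y /\ din t y /\ exists x, P x /\ dout t x /\ f x = y
      end y).
    + intros y [Ky [x [Kx e]]].
      destruct (classic (In y (p :: F ++ map f F))) as [i|ni]; [exists 0%nat; exact i|].
      assert (Py : P y).
      { destruct (HF y Ky); [split; auto|]. destruct ni; right; apply in_or_app; auto. }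
      assert (Px : P x).
      { destruct (HF x Kx); [split; auto|]. destruct ni; right; apply in_or_app; right.
        rewrite <- e. apply in_map; auto. }
      destruct (classic (x = y)) as [<-|nxy].
      * destruct ni; left. symmetry; auto.
      * destruct (sep x y nxy) as [t [iy ox]]. exists (S t).
        split; [exact Py|]. split; [exact iy|]. exists x; auto.
    + apply Hh_zero_countable_union; [exact Hh|]. intros [|t].
      * apply Hh_zero_list; [exact Hd|exact Hh].
      * exact (tree_null X d Hd P rho r l din dout Hlev Href t f HfP).
Qed.

End Genericity.

(** * Genericity from countably many pairs of regions *)

Theorem mainTheorem3 (X : Type) (d : X -> X -> R) (HX : polish X d) :
  generic X d (fun K : KX X d =>
    finite_set X (proj1_sig K) \/
    exists h : R -> R,
      gauge h /\ continuous_on_nonneg h /\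
      Hh_pos_finite X d h (proj1_sig K) /\
      forall f : X -> X, weak_contraction X d (proj1_sig K) f ->
        Hh_zero X d h (fun y => proj1_sig K y /\ image X f (proj1_sig K) y)).
Proof.
  destruct HX as [Hd [_ [s Hs]]].
  pose (rad := fun t => / (INR (snd (of_nat t)) + 1)).
  pose (din := fun t y => exists c, s (fst (of_nat t)) = Some c /\ d c y < rad t).
  pose (dout := fun t x => exists c, s (fst (of_nat t)) = Some c /\ 2 * rad t <= d c x).
  assert (radp : forall t, 0 < rad t).
  { intros t. apply Rinv_0_lt_compat. pose proof (pos_INR (snd (of_nat t))). lra. }
  assert (gap : forall t x y, din t x -> dout t y -> rad t <= d x y).
  { intros t x y [c [e cx]] [c' [e' cy]]. rewrite e in e'. injection e' as <-.
    pose proof (metric_tri X d Hd c x y). lra. }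
  assert (sep : forall x y, x <> y -> exists t, din t y /\ dout t x).
  { intros x y ne. pose proof (metric_lt_pos X d Hd x y ne) as p.
    destruct (INR_unbounded (3 / d x y)) as [j Hj].
    (* If the centre [c] is within the radius of [y], a distance of three radii leaves at least two
       between [c] and [x]. *)
    assert (J : 3 * / (INR j + 1) <= d x y).
    { pose proof (pos_INR j). apply Rmult_le_reg_r with (INR j + 1); [lra|].
      rewrite Rmult_assoc, Rinv_l by lra.
      apply (Rmult_lt_compat_r (d x y)) in Hj; [|exact p].
      replace (3 / d x y * d x y) with 3 in Hj by (field; lra). nra. }
    assert (jp : 0 < / (INR j + 1)).
    { apply Rinv_0_lt_compat. pose proof (pos_INR j). lra. }
    destruct (Hs y _ jp) as [k [c [e yc]]].
    exists (to_nat (k, j)). unfold din, dout, rad. rewrite cancel_of_to. cbn [fst snd].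
    split; exists c; (split; [exact e|]).
    - rewrite metric_sym by exact Hd. exact yc.
    - pose proof (metric_tri X d Hd x c y).
      rewrite (metric_sym X d Hd x c), (metric_sym X d Hd c y) in *. lra. }
  (* [k] codes ((t, n), i): a pair of regions, a ratio and a scale. *)
  exists (fun k K => ~ good X d (din (fst (of_nat (fst (of_nat k)))))
    (dout (fst (of_nat (fst (of_nat k))))) (snd (of_nat (fst (of_nat k))))
    (snd (of_nat k)) (proj1_sig K)).
  split.
  - intros k. apply (nowhere_dense_of_dense_interior X d).
    intros K e ep.
    apply (good_dense_interior X d Hd) with (g := rad (fst (of_nat (fst (of_nat k))))); auto.
  - intros K nP. apply NNPP. intros none. apply nP.
    apply (good_conclusion X d Hd (proj1_sig K) din dout (proj2_sig K) sep).
    intros t n i. apply NNPP. intros ng. apply none.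
    exists (to_nat (to_nat (t, n), i)). rewrite !cancel_of_to. cbn [fst snd].
    rewrite !cancel_of_to. exact ng.
Qed.
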